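(* Let $T>0$, $H\in(1/2,1)$, $x_0>0$, $\alpha,\beta,\sigma\in\mathbb{R}$ with $\beta\neq0$, let $B^H$ be a fractional Brownian motion with Hurst index $H$, and let $\varepsilon\in(0,H-\frac12)$, $H_\varepsilon=\frac1{H-\varepsilon}$. The stochastic process $$X_t=\exp\bigg\{e^{-\beta t}\ln x_0+\frac\alpha\beta\big(1-e^{-\beta t}\big)+\sigma\int_0^te^{-\beta(t-s)}\,dB^H_s\bigg\},\qquad 0\leq t\leq T,$$ belongs for almost all $\omega$ to $C\mathcal{W}_{H_\varepsilon}([0,T])$ and is the unique solution, in the class of processes almost all of whose sample paths belong to $C\mathcal{W}_{H_\varepsilon}([0,T])$, of the fractional Gompertz equation $$X_t=x_0+\int_0^t(\alpha X_s-\beta X_s\ln X_s)\,ds+\sigma\int_0^tX_s\,dB^H_s,\qquad 0\leq t\leq T.$$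
   Context: $B^H$ is a fractional Brownian motion with Hurst index $H$: a real continuous centered Gaussian process with $\mathbf{E}(B^H_tB^H_s)=\frac12(s^{2H}+t^{2H}-|t-s|^{2H})$. For $p>0$, $C\mathcal{W}_p([a,b])$ is the set of continuous functions $f:[a,b]\to\mathbb{R}$ of bounded $p$-variation, i.e. with $\sup\sum_{k=1}^n|f(x_k)-f(x_{k-1})|^p<\infty$, the supremum being over all partitions $a=x_0<x_1<\dots<x_n=b$. Integrals with respect to $B^H$ are pathwise Riemann–Stieltjes integrals (they exist because almost all paths of $B^H$ and the integrands are continuous with bounded $H_\varepsilon$-variation and $H_\varepsilon<2$). Solutions are understood pathwise for almost all $\omega$, with positive sample paths so that $\ln X_s$ is defined; uniqueness means that any two solutions coincide on $[0,T]$ for almost all $\omega$. *)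

(* Defs.v *)
From HB Require Import structures.
From mathcomp Require Import all_boot all_order all_algebra.
From mathcomp Require Import all_classical all_reals all_analysis.

Set Implicit Arguments.
Unset Strict Implicit.
Unset Printing Implicit Defensive.
Import Order.TTheory GRing.Theory Num.Theory.
Import numFieldNormedType.Exports.
Local Open Scope classical_set_scope.
Local Open Scope ring_scope.

Section paths.
Context {R : realType}.
Implicit Types (f g x : R -> R) (a b p : R) (s : seq R).

(* [s] lists x_1 < ... < x_n = b; the subdivision points are a :: s, as in
   [variation], of which this is the p-th power version. *)
Definition pvariation p a b f s : R :=
  let F := f \o nth b (a :: s) in
  \sum_(0 <= n < size s) `|F n.+1 - F n| `^ p.

Definition bounded_pvariation p a b f : Prop :=
  has_ubound [set pvariation p a b f s | s in itv_partition a b].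

Definition CW p a b f : Prop :=
  {within `[a, b], continuous f} /\ bounded_pvariation p a b f.

(* [xi k] is the tag in [x_k, x_{k+1}]. *)
Definition tags_of a b s (xi : nat -> R) : Prop :=
  forall k, (k < size s)%N ->
    nth b (a :: s) k <= xi k <= nth b (a :: s) k.+1.

Definition mesh_lt a b s (delta : R) : Prop :=
  forall k, (k < size s)%N ->
    nth b (a :: s) k.+1 - nth b (a :: s) k < delta.

Definition RS_sum f g a b s (xi : nat -> R) : R :=
  \sum_(0 <= k < size s)
    f (xi k) * (g (nth b (a :: s) k.+1) - g (nth b (a :: s) k)).

Definition is_RS_integral f g a b (I : R) : Prop :=
  forall e : R, 0 < e -> exists2 delta : R, 0 < delta &
    forall s xi, itv_partition a b s -> tags_of a b s xi ->
      mesh_lt a b s delta -> `|RS_sum f g a b s xi - I| < e.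

Definition RS_integrable f g a b : Prop :=
  exists I, is_RS_integral f g a b I.

(* The limit of the Riemann-Stieltjes sums, which is unique when a <= b;
   arbitrarily 0 when it does not exist. *)
Definition RS_integral f g a b : R := xget 0 (is_RS_integral f g a b).

End paths.

Section processes.
Context {R : realType} (d : measure_display) (Om : measurableType d).
Variable P : probability Om R.

(* Degenerate Gaussian laws are Dirac masses: [normal_prob m 0] is not. *)
Definition gaussian_rv (Y : Om -> R) : Prop :=
  exists m sd : R, 0 <= sd /\
    forall A : set R, measurable A ->
      P (Y @^-1` A) = if sd == 0 then \d_m A else normal_prob m sd A.

Definition gaussian_process (B : R -> {RV P >-> R}) : Prop :=
  forall (n : nat) (t c : 'I_n -> R), (forall i, 0 <= t i) ->
    gaussian_rv (fun w => \sum_(i < n) c i * B (t i) w).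

(* The time set is [0, +oo[; values at negative times are irrelevant. *)
Definition fBm (H : R) (B : R -> {RV P >-> R}) : Prop :=
  [/\ {ae P, forall w, {within `[0, +oo[, continuous (fun t => B t w)}},
      gaussian_process B,
      (forall t, 0 <= t -> ('E_P[B t] = 0)%E) &
      (forall t s, 0 <= t -> 0 <= s ->
        'E_P[(fun w => B t w * B s w)%R]%E =
          (2^-1 * (s `^ (2 * H) + t `^ (2 * H) - `|t - s| `^ (2 * H)))%:E)].

(* Each X_t is measurable for the P-completion of the sigma-algebra, i.e. is
   almost everywhere equal to a random variable. The completion is needed
   because pathwise integrals are only defined outside a null set. *)
Definition process_on (T : R) (X : R -> Om -> R) : Prop :=
  forall t, 0 <= t <= T -> exists Y : {RV P >-> R}, X t = Y %[ae P].

Definition CW_process (p T : R) (X : R -> Om -> R) : Prop :=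
  process_on T X /\ {ae P, forall w, CW p 0 T (fun t => X t w)}.

Definition gompertz_path (T alpha beta sigma x0 : R) (b x : R -> R) : Prop :=
  forall t, 0 <= t <= T ->
    [/\ 0 < x t,
        RS_integrable x b 0 t &
        x t = x0
              + \int[lebesgue_measure]_(s in `[0, t])
                  (alpha * x s - beta * x s * ln (x s))
              + sigma * RS_integral x b 0 t].

Definition gompertz_solution (T alpha beta sigma x0 : R)
    (B : R -> {RV P >-> R}) (X : R -> Om -> R) : Prop :=
  {ae P, forall w,
    gompertz_path T alpha beta sigma x0 (fun t => B t w) (fun t => X t w)}.

Definition gompertz_kernel (beta t s : R) : R := expR (- beta * (t - s)).

Definition gompertz_process (alpha beta sigma x0 : R)
    (B : R -> {RV P >-> R}) (t : R) (w : Om) : R :=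
  expR (expR (- beta * t) * ln x0
        + alpha / beta * (1 - expR (- beta * t))
        + sigma * RS_integral (gompertz_kernel beta t) (fun s => B s w) 0 t).

End processes.

(* Main.v *)
(** The solution and the uniqueness argument are pathwise. If [b] is a Hölder path
    of exponent [gamma > 1/2], then [ln X] is the sum of a differentiable function
    and [sigma b], and the squares of its increments over a partition add up to
    something that vanishes with the mesh, so the Riemann-Stieltjes sums of [X]
    against [b] converge by a second-order expansion of the exponential.
    Conversely, if [y] solves the equation and has finite [p]-variation with
    [p < 2], the Saks-Henstock lemma (the absolute local errors of the sums of an
    integrable pair have a small sum) gives the chain rule for [ln y], whence the linear
    equation [d ln y = (alpha - beta ln y) dt + sigma db]; the difference of two
    logarithms solves [D' = - beta D] with [D(0) = 0]. No Young-Loève estimate is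
    needed.

    The paths of the fractional Brownian motion are Hölder of every exponent
    below [H]: Gaussian tails and the Borel-Cantelli lemma control the increments
    over dyadic intervals, and a chaining argument extends this to all times. *)

Require Import Defs.
From HB Require Import structures.
From mathcomp Require Import all_boot all_order all_algebra.
From mathcomp Require Import all_classical all_reals all_analysis.
From mathcomp Require Import measurable_realfun ring lra.
Import Order.TTheory GRing.Theory Num.Theory.
Import numFieldNormedType.Exports.
Set Implicit Arguments.
Unset Strict Implicit.
Unset Printing Implicit Defensive.
Local Open Scope classical_set_scope.
Local Open Scope ring_scope.

(** * Riemann-Stieltjes sums over tagged partitions *)

Section tagged_partitions.
Context {R : realType}.
Implicit Types (a b c dl p : R) (f g G : R -> R) (l : seq (R * R)).
Implicit Types (w : R -> R -> R -> R).

(* An entry (xi, c) of the list is the tag xi of the piece that ends at c. *)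
Fixpoint tagged_partition dl a b l : bool :=
  if l is (x, c) :: l' then
    [&& a < c, a <= x <= c, c - a < dl & tagged_partition dl c b l']
  else a == b.

Fixpoint piece_sum w a l : R :=
  if l is (x, c) :: l' then w x a c + piece_sum w c l' else 0.

Definition RS_piece f g (x u v : R) : R := f x * (g v - g u).

Lemma tagged_partition_le dl a b l : tagged_partition dl a b l -> a <= b.
Proof.
elim: l a => [|[x c] l IH] a /=; first by move=> /eqP->.
by move=> /and4P[ac _ _ /IH]; apply: le_trans; exact: ltW.
Qed.

Lemma tagged_partition_cat dl a b c l l' : tagged_partition dl a b l ->
  tagged_partition dl b c l' -> tagged_partition dl a c (l ++ l').
Proof.
move=> + h; elim: l a => [|[x y] l IH] a /=; first by move=> /eqP->.
by move=> /and4P[-> -> -> /IH ->].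
Qed.

Lemma tagged_partition_widen dl dl' a b l : dl <= dl' ->
  tagged_partition dl a b l -> tagged_partition dl' a b l.
Proof.
move=> dd; elim: l a => [|[x y] l IH] a //=.
by move=> /and4P[-> -> ya /IH ->]; rewrite (lt_le_trans ya dd).
Qed.

Lemma left_tagged_partition_exists dl a b : 0 < dl -> a <= b ->
  exists2 l, tagged_partition dl a b l &
    forall w, piece_sum w a l = piece_sum (fun _ u v => w u u v) a l.
Proof.
move=> d0 ab.
have [n nb] : exists n : nat, b - a < n%:R * (dl / 2).
  exists (Num.bound ((b - a) / (dl / 2))).
  rewrite -ltr_pdivrMr ?divr_gt0//; apply: archi_boundP.
  by rewrite divr_ge0 ?subr_ge0 ?divr_ge0// ltW.
elim: n a ab nb => [|n IH] a ab nb; first by exfalso; lra.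
have [bd|db] := ltP (b - a) dl.
  have [->|nab] := eqVneq a b; first by exists [::] => /=.
  by exists [:: (a, b)] => //; rewrite /= lt_neqAle nab ab lexx bd eqxx.
have [|| l hl hw] := IH (a + dl / 2).
- lra.
- by move: nb; rewrite -natr1; lra.
exists ((a, a + dl / 2) :: l); last by move=> w /=; rewrite hw.
rewrite /= hl lexx !andbT /=.
by apply/and3P; split; lra.
Qed.

Lemma tagged_partition_exists dl a b : 0 < dl -> a <= b ->
  exists l, tagged_partition dl a b l.
Proof. by move=> d0 /(left_tagged_partition_exists d0)[l hl _]; exists l. Qed.

Lemma ler_piece_sum w w' dl a b l :
  (forall x u v, a <= u -> v <= b -> u <= x <= v -> u < v -> v - u < dl ->
     w x u v <= w' x u v) ->
  tagged_partition dl a b l -> piece_sum w a l <= piece_sum w' a l.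
Proof.
elim: l a => [|[x c] l IH] a //= H /and4P[ac axc cad hl].
apply: lerD.
  by apply: H => //; exact: tagged_partition_le hl.
by apply: IH hl => y u v cu *; apply: H => //; exact: le_trans (ltW ac) cu.
Qed.

Lemma eq_piece_sum w w' dl a b l :
  (forall x u v, a <= u -> v <= b -> u <= x <= v -> u < v -> v - u < dl ->
     w x u v = w' x u v) ->
  tagged_partition dl a b l -> piece_sum w a l = piece_sum w' a l.
Proof.
move=> H hl; apply/eqP; rewrite eq_le.
by apply/andP; split; apply: ler_piece_sum hl => *; rewrite H.
Qed.

Lemma piece_sum_norm w a l :
  `|piece_sum w a l| <= piece_sum (fun x u v => `|w x u v|) a l.
Proof.
elim: l a => [|[x c] l IH] a /=; first by rewrite normr0.
exact: le_trans (ler_normD _ _) (lerD _ _).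
Qed.

Lemma piece_sumD w w' a l : piece_sum (fun x u v => w x u v + w' x u v) a l =
  piece_sum w a l + piece_sum w' a l.
Proof. by elim: l a => [|[x c] l IH] a /=; rewrite ?addr0// IH; ring. Qed.

Lemma piece_sumZ k w a l : piece_sum (fun x u v => k * w x u v) a l =
  k * piece_sum w a l.
Proof. by elim: l a => [|[x c] l IH] a /=; rewrite ?mulr0// IH; ring. Qed.

Lemma piece_sumB w w' a l : piece_sum (fun x u v => w x u v - w' x u v) a l =
  piece_sum w a l - piece_sum w' a l.
Proof. by elim: l a => [|[x c] l IH] a /=; rewrite ?subr0// IH; ring. Qed.

Lemma piece_sum_cat w dl a b l l' : tagged_partition dl a b l ->
  piece_sum w a (l ++ l') = piece_sum w a l + piece_sum w b l'.
Proof.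
elim: l a => [|[x c] l IH] a /=; first by move=> /eqP->; rewrite add0r.
by move=> /and4P[_ _ _ /IH ->]; rewrite addrA.
Qed.

Lemma piece_sum_telescope G dl a b l : tagged_partition dl a b l ->
  piece_sum (fun _ u v => G v - G u) a l = G b - G a.
Proof.
elim: l a => [|[x c] l IH] a /=; first by move=> /eqP->; rewrite subrr.
by move=> /and4P[_ _ _ /IH ->]; ring.
Qed.

Let tag_nth l k : R := nth 0 (unzip1 l) k.

Lemma RS_sum_cons f g a b c s xi : RS_sum f g a b (c :: s) xi =
  RS_piece f g (xi 0%N) a c + RS_sum f g c b s (fun k => xi k.+1).
Proof. by rewrite /RS_sum /= big_ltn// big_add1. Qed.

Lemma RS_sum_zip f g a b s xi :
  RS_sum f g a b s xi = piece_sum (RS_piece f g) a (zip (mkseq xi (size s)) s).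
Proof.
elim: s a xi => [|c s IH] a xi; first by rewrite /RS_sum big_geq.
by rewrite RS_sum_cons IH /mkseq /= -[in iota 1 _](addn0 1%N) iotaDl -map_comp.
Qed.

Lemma RS_sum_unzip f g a b l :
  RS_sum f g a b (unzip2 l) (tag_nth l) = piece_sum (RS_piece f g) a l.
Proof.
elim: l a => [|[x c] l IH] a; first by rewrite /RS_sum big_geq.
by rewrite /= RS_sum_cons -IH.
Qed.

Lemma tagged_partition_zip dl a b s xi : itv_partition a b s ->
  tags_of a b s xi -> mesh_lt a b s dl ->
  tagged_partition dl a b (zip (mkseq xi (size s)) s).
Proof.
elim: s a xi => [|c s IH] a xi; first by move=> [].
move=> [/= /andP[ac cs] lb] tg ms.
rewrite ac (tg 0%N erefl) (ms 0%N erefl) /=.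
rewrite -[in iota 1 _](addn0 1%N) iotaDl -map_comp.
by apply: (IH c (fun k => xi k.+1)) => // k ks; [exact: (tg k.+1)|exact: (ms k.+1)].
Qed.

Lemma tagged_partition_unzip dl a b l : tagged_partition dl a b l ->
  [/\ itv_partition a b (unzip2 l), tags_of a b (unzip2 l) (tag_nth l) &
      mesh_lt a b (unzip2 l) dl].
Proof.
elim: l a => [|[x c] l IH] a /=; first by move=> /eqP->.
move=> /and4P[ac axc cad /IH [[pl ll] tg ms]].
split; first by split; rewrite //= ac.
- by case=> //= k; exact: tg.
- by case=> //= k; exact: ms.
Qed.

Lemma is_RS_integralE f g a b I : is_RS_integral f g a b I <->
  forall e : R, 0 < e -> exists2 dl : R, 0 < dl &
    forall l, tagged_partition dl a b l ->
      `|piece_sum (RS_piece f g) a l - I| < e.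
Proof.
split=> h e /h [dl d0 hd]; exists dl => //.
  move=> l /tagged_partition_unzip[? ? ?].
  by rewrite -(RS_sum_unzip _ _ _ b); exact: hd.
by move=> s xi ? ? ?; rewrite RS_sum_zip; apply/hd/tagged_partition_zip.
Qed.

Lemma pvariation_unzip p a b f l : pvariation p a b f (unzip2 l) =
  piece_sum (fun _ u v => `|f v - f u| `^ p) a l.
Proof.
elim: l a => [|[x c] l IH] a; first by rewrite /pvariation big_geq.
by rewrite /= -IH /pvariation /= big_ltn// big_add1.
Qed.

(* The mesh is at most b - a, hence the choice of bound. *)
Lemma pvariation_piece_sum p a b f s : itv_partition a b s ->
  exists2 l, tagged_partition (b - a + 1) a b l &
    pvariation p a b f s = piece_sum (fun _ u v => `|f v - f u| `^ p) a l.
Proof.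
move=> ps; exists (zip s s); last first.
  by rewrite -(@pvariation_unzip _ _ b) unzip2_zip.
have: forall dl, b - a < dl -> tagged_partition dl a b (zip s s).
  elim: s a ps => [|c s IH] a [] //= /andP[ac pc] lb dl abd.
  have cb := itv_partition_le (conj pc lb).
  rewrite ac (ltW ac) lexx IH//=; last by lra.
  by rewrite andbT; lra.
by apply; lra.
Qed.

Lemma RS_integral_uniq f g a b I J : a <= b ->
  is_RS_integral f g a b I -> is_RS_integral f g a b J -> I = J.
Proof.
move=> ab /is_RS_integralE hI /is_RS_integralE hJ.
apply/eqP/negPn/negP => IJ.
have e0 : 0 < `|I - J| / 2 by rewrite divr_gt0// normr_gt0 subr_eq0.
have [d1 d10 h1] := hI _ e0; have [d2 d20 h2] := hJ _ e0.
have d0 : 0 < Num.min d1 d2 by rewrite lt_min d10.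
have [l hl] := tagged_partition_exists d0 ab.
have := h1 l (tagged_partition_widen _ hl).
have := h2 l (tagged_partition_widen _ hl).
rewrite !ge_min !lexx ?orbT => /(_ erefl) + /(_ erefl).
set s := piece_sum _ _ _ => hb ha.
have := ler_distD s I J; rewrite (distrC I s) => h.
by lra.
Qed.

Lemma RS_integral_val f g a b I : a <= b -> is_RS_integral f g a b I ->
  RS_integral f g a b = I.
Proof.
move=> ab hI; rewrite /RS_integral; refine (RS_integral_uniq ab _ hI).
by apply: (@xgetPex _ 0 (is_RS_integral f g a b)); exists I.
Qed.

Lemma RS_integralP f g a b : RS_integrable f g a b ->
  is_RS_integral f g a b (RS_integral f g a b).
Proof. exact: (@xgetPex _ 0 (is_RS_integral f g a b)). Qed.

Lemma is_RS_integral_point f g a : is_RS_integral f g a a 0.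
Proof.
apply/is_RS_integralE => e e0.
exists 1 => // -[|[x c] l] /=; first by rewrite subrr normr0.
by move=> /and4P[c0 _ _ /tagged_partition_le]; rewrite leNgt c0.
Qed.

Lemma eq_is_RS_integral f f' g g' a b I :
  (forall x, a <= x <= b -> f x = f' x) ->
  (forall x, a <= x <= b -> g x = g' x) ->
  is_RS_integral f g a b I -> is_RS_integral f' g' a b I.
Proof.
move=> ff gg /is_RS_integralE h; apply/is_RS_integralE => e /h[dl d0 hd].
exists dl => // l hl; rewrite -(@eq_piece_sum (RS_piece f g) _ _ _ _ _ _ hl) ?hd//.
move=> x u v au vb /andP[ux xv] uv _.
by rewrite /RS_piece ff ?gg//; apply/andP; split; lra.
Qed.

Lemma is_RS_integral_sewing f g G a b : a <= b ->
  (forall e, 0 < e -> exists2 dl, 0 < dl &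
     forall x u v, a <= u -> v <= b -> u <= x <= v -> u < v -> v - u < dl ->
       `|RS_piece f g x u v - (G v - G u)| <= e * (v - u)) ->
  is_RS_integral f g a b (G b - G a).
Proof.
move=> ab H; apply/is_RS_integralE => e e0.
have k0 : 0 < e / (b - a + 1) by rewrite divr_gt0//; lra.
have [dl d0 hd] := H _ k0; exists dl => // l hl.
rewrite -(piece_sum_telescope G hl) -piece_sumB.
apply: le_lt_trans (piece_sum_norm _ _ _) _.
apply: le_lt_trans (ler_piece_sum hd hl) _.
rewrite piece_sumZ (piece_sum_telescope id hl) /=.
by rewrite mulrAC ltr_pdivrMr ?ltr_pM2l//; lra.
Qed.

Section saks_henstock.
Variables (f g : R -> R) (T : R).
Hypothesis fgT : forall t, 0 <= t <= T -> RS_integrable f g 0 t.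
Let F t := RS_integral f g 0 t.
Let r x u v := F v - F u - RS_piece f g x u v.

Let fine_piece dl e u v : 0 < dl -> 0 < e -> 0 <= u -> u <= v -> v <= T ->
  exists2 l, tagged_partition dl u v l &
    `|F v - F u - piece_sum (RS_piece f g) u l| <= e.
Proof.
move=> d0 e0 u0 uv vT.
have e20 : 0 < e / 2 by rewrite divr_gt0.
have uT : 0 <= u <= T by rewrite u0 (le_trans uv).
have v0T : 0 <= v <= T by rewrite (le_trans u0).
have /is_RS_integralE/(_ _ e20)[d1 d10 h1] := RS_integralP (fgT uT).
have /is_RS_integralE/(_ _ e20)[d2 d20 h2] := RS_integralP (fgT v0T).
have dm0 : 0 < Num.min dl (Num.min d1 d2) by rewrite !lt_min d0 d10.
have [l0 hl0] := tagged_partition_exists dm0 u0.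
have [l hl] := tagged_partition_exists dm0 uv.
have := h1 l0 (tagged_partition_widen _ hl0).
have := h2 _ (tagged_partition_widen _ (tagged_partition_cat hl0 hl)).
rewrite !ge_min !lexx ?orbT => /(_ erefl) + /(_ erefl).
rewrite (piece_sum_cat _ _ hl0) => /ltW k2 /ltW k1.
exists l; first by apply: tagged_partition_widen hl; rewrite ge_min lexx.
move: k1 k2; rewrite -/(F u) -/(F v) !ler_norml => /andP[? ?] /andP[? ?].
by apply/andP; split; lra.
Qed.

(* Refining the pieces outside Q until their sums reach the integral leaves the
   error of the pieces in Q. *)
Let saks_henstock_sub (Q : R -> R -> R -> bool) t e dl : 0 <= t <= T -> 0 < dl ->
  (forall l, tagged_partition dl 0 t l ->
     `|piece_sum (RS_piece f g) 0 l - F t| < e) ->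
  forall l, tagged_partition dl 0 t l ->
    `|piece_sum (fun x u v => if Q x u v then r x u v else 0) 0 l| <= e.
Proof.
move=> /andP[t0 tT] d0 he l hl; apply/ler_addgt0Pr => k k0.
pose n : R := (size l).+1%:R.
have n0 : 0 < n by rewrite ltr0n.
have kn0 : 0 < k / n by rewrite divr_gt0.
suff [l' hl' le] : exists2 l', tagged_partition dl 0 t l' &
    `|F t - F 0 - piece_sum (RS_piece f g) 0 l'
      - piece_sum (fun x u v => if Q x u v then r x u v else 0) 0 l|
      <= (size l)%:R * (k / n).
  have F0 : F 0 = 0 by apply: RS_integral_val (is_RS_integral_point _ _ _).
  have nk : (size l)%:R * (k / n) <= k.
    by rewrite mulrCA ger_pMr// ler_pdivrMr// mul1r ler_nat leqnSn.
  have /ltW := he _ hl'; have := le_trans le nk.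
  rewrite F0 !ler_norml => /andP[? ?] /andP[? ?].
  by apply/andP; split; lra.
have: forall a, 0 <= a -> tagged_partition dl a t l ->
    exists2 l', tagged_partition dl a t l' &
    `|F t - F a - piece_sum (RS_piece f g) a l'
      - piece_sum (fun x u v => if Q x u v then r x u v else 0) a l|
      <= (size l)%:R * (k / n); last by apply.
move: (k / n) kn0 => z z0 {n n0 hl}.
elim: l => [|[x c] l IH] a a0 /=.
  by move=> /eqP <-; exists [::]; rewrite /= ?eqxx// !subrr normr0 mul0r.
move=> /and4P[ac axc cad hl].
have c0 : 0 <= c by rewrite (le_trans a0)// ltW.
have [l' hl' IHe] := IH c c0 hl.
have ct : c <= T := le_trans (tagged_partition_le hl) tT.
case: ifP => _.
  exists ((x, c) :: l'); first by rewrite /= ac axc cad.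
  rewrite /= /r -natr1 mulrDl mul1r.
  by move: IHe; rewrite !ler_norml => /andP[? ?]; apply/andP; split; lra.
have [m hm he'] := fine_piece d0 z0 a0 (ltW ac) ct.
exists (m ++ l'); first exact: tagged_partition_cat hm hl'.
rewrite (piece_sum_cat _ _ hm) -natr1 mulrDl mul1r.
move: IHe he'; rewrite !ler_norml => /andP[? ?] /andP[? ?].
by apply/andP; split; lra.
Qed.

Lemma saks_henstock t e : 0 <= t <= T -> 0 < e ->
  exists2 dl, 0 < dl & forall l, tagged_partition dl 0 t l ->
    piece_sum (fun x u v => `|RS_integral f g 0 v - RS_integral f g 0 u
                             - RS_piece f g x u v|) 0 l <= e.
Proof.
move=> tT e0; have e20 : 0 < e / 2 by rewrite divr_gt0.
have /is_RS_integralE/(_ _ e20)[dl d0 hd] := RS_integralP (fgT tT).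
exists dl => // l hl.
have h1 := saks_henstock_sub (fun x u v => 0 <= r x u v) tT d0 hd hl.
have h2 := saks_henstock_sub (fun x u v => r x u v < 0) tT d0 hd hl.
rewrite (_ : piece_sum _ _ _ =
   piece_sum (fun x u v => if 0 <= r x u v then r x u v else 0) 0 l -
   piece_sum (fun x u v => if r x u v < 0 then r x u v else 0) 0 l).
  by move: h1 h2; rewrite !ler_norml => /andP[? ?] /andP[? ?]; lra.
rewrite -piece_sumB; apply: eq_piece_sum hl => x u v _ _ _ _ _.
rewrite -/(r x u v); case: ltP => h; rewrite ?sub0r ?subr0.
  by rewrite ltr0_norm.
by rewrite ger0_norm.
Qed.

End saks_henstock.
End tagged_partitions.

(** * Pathwise calculus *)

Section calculus.
Context {R : realType}.
Implicit Types (f g F : R -> R) (a b t u v x T M e : R).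

Lemma ler_deriv_increment F f a b M : a <= b ->
  (forall x, a <= x <= b -> is_derive x 1 F (f x)) ->
  (forall x, a <= x <= b -> `|f x| <= M) -> `|F b - F a| <= M * (b - a).
Proof.
move=> ab dF fM.
have [||x + ->] := @MVT_segment R F f a b ab.
- by move=> x; rewrite in_itv/= => /andP[/ltW ax /ltW xb]; apply: dF; rewrite ax.
- apply: derivable_within_continuous => x; rewrite in_itv/= => xab.
  by have := dF x xab; case.
rewrite in_itv/= => xab.
by rewrite normrM [X in _ * X]ger0_norm ?subr_ge0// ler_wpM2r ?subr_ge0// fM.
Qed.

Lemma segment_uniform_continuity f a b : continuous f -> forall e, 0 < e ->
  exists2 dl, 0 < dl & forall x y, a <= x <= b -> a <= y <= b ->
    `|x - y| < dl -> `|f x - f y| <= e.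
Proof.
move=> cf e e0; apply: contrapT => H.
have H' n : exists xy : R * R, [/\ a <= xy.1 <= b, a <= xy.2 <= b,
    `|xy.1 - xy.2| < n.+1%:R^-1 & e < `|f xy.1 - f xy.2|].
  apply: contrapT => Hn; apply: H; exists n.+1%:R^-1; first by rewrite invr_gt0.
  move=> x y xab yab xy; rewrite leNgt; apply/negP => fxy.
  by apply: Hn; exists (x, y).
have [u hu] := choice H'.
have [|x [xab]] := @segment_compact _ a b
    (fmap (fst \o u) eventually) (fmap_proper_filter (fst \o u) eventually_filter).
  by exists 0%N => // n _ /=; rewrite in_itv/=; case: (hu n).
rewrite /= => cx.
have e20 : 0 < e / 2 by rewrite divr_gt0.
have /cvgrPdist_lt/(_ _ e20)[r /= r0 hr] := cf x.
have r20 : 0 < r / 2 by rewrite divr_gt0.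
have [N N0] : exists N : nat, N.+1%:R^-1 < r / 2.
  exists (Num.bound (r / 2)^-1); rewrite invf_plt ?posrE//.
  apply: lt_trans (archi_boundP _) _; first by rewrite invr_ge0 ltW.
  by rewrite ltr_nat.
have [|z [[n /= Nn <-] xz]] := cx [set (fst \o u) n | n in [set n | (N <= n)%N]]
    (ball x (r / 2)) _ (nbhsx_ballx _ _ r20).
  by exists N => // n /= Nn; exists n.
have [u1 u2 u12 ff] := hu n.
have nr : `|(u n).1 - (u n).2| < r / 2.
  by apply: lt_trans N0; apply: lt_le_trans u12 _; rewrite lef_pV2 ?posrE// ler_nat.
have f1 : `|f x - f (u n).1| < e / 2.
  by apply: hr; apply: lt_le_trans xz _; lra.
have f2 : `|f x - f (u n).2| < e / 2.
  apply: hr => /=; apply: le_lt_trans (ler_distD (u n).1 _ _) _.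
  by rewrite (splitr r) ltrD.
move: ff; apply/negP; rewrite -leNgt.
apply: le_trans (ler_distD (f x) _ _) _.
by rewrite (splitr e) lerD ?ltW// distrC.
Qed.

Lemma segment_bounded f a b : continuous f ->
  exists2 M, 0 < M & forall x, a <= x <= b -> `|f x| <= M.
Proof.
move=> cf; have [ab|ba] := leP a b; last first.
  by exists 1 => // x /andP[? ?]; exfalso; lra.
have cn : {within `[a, b], continuous (fun x => `|f x|)}.
  apply: continuous_subspaceT => x; apply: continuous_comp; first exact: cf.
  exact: norm_continuous.
have [c _ hc] := EVT_max ab cn; exists (`|f c| + 1); first by rewrite ltr_pwDr.
by move=> x xab; apply: le_trans (hc x _) _; rewrite ?in_itv//= lerDl.
Qed.

Lemma primitive_exists f : continuous f -> exists2 F : R -> R,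
  (forall x, 0 <= x -> is_derive x 1 F (f x)) &
  (forall t, 0 <= t ->
    \int[lebesgue_measure]_(s in `[0, t]) f s = F t - F 0).
Proof.
move=> cf.
pose F x := \int[lebesgue_measure]_(t in `[-1, x]) f t.
have intf a b : lebesgue_measure.-integrable `[a, b] (EFin \o f).
  apply: continuous_compact_integrable; first exact: segment_compact.
  exact: continuous_subspaceT.
have dF x : 0 <= x -> is_derive x 1 F (f x).
  move=> x0; have x1 : -1 < x by lra.
  have xx : x < x + 1 by rewrite ltrDl.
  have [d1 d2] := @continuous_FTC1_closed R f (-1) x (x + 1) xx (intf _ _) x1 (cf x).
  by apply: (DeriveDef d1); rewrite -derive1E d2.
exists F => // t; rewrite le_eqVlt => /orP[/eqP <-|t0].
  by rewrite set_itv1 Rintegral_set1 subrr.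
have cF x : 0 <= x -> {for x, continuous F}.
  move=> /dF[dx _]; apply/differentiable_continuous.
  by rewrite -derivable1_diffP.
rewrite /Rintegral (@continuous_FTC2 R f F 0 t t0)//.
- exact: continuous_subspaceT.
- split.
  + by move=> x; rewrite in_itv/= => /andP[/ltW /dF[]].
  + exact/cvg_at_right_filter/cF.
  + exact/cvg_at_left_filter/cF/ltW.
- move=> x; rewrite in_itv/= => /andP[/ltW /dF[_ <-] _].
  by rewrite derive1E.
Qed.
End calculus.

Section paths.
Context {R : realType}.
Implicit Types (f g F A N b : R -> R) (s t u v x y z T M C e gamma : R).

Definition clamp T t : R := Num.max 0 (Num.min t T).

Lemma clamp_itv T t : 0 <= T -> 0 <= clamp T t <= T.
Proof.
by move=> T0; rewrite /clamp le_max lexx/= ge_max T0 ge_min lexx orbT.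
Qed.

Lemma clamp_id T t : 0 <= t <= T -> clamp T t = t.
Proof. by move=> /andP[t0 tT]; rewrite /clamp min_l// max_r. Qed.

Lemma continuous_comp_clamp f T : 0 <= T -> {within `[0, T], continuous f} ->
  continuous (f \o clamp T).
Proof.
move=> T0 /subspace_continuousP cf t.
apply: (@cvg_comp _ _ _ (clamp T) f _ (within `[0, T] (nbhs (clamp T t)))); last first.
  by apply: cf; rewrite /= in_itv/= clamp_itv.
move=> B /= hB.
have cc : {for t, continuous (clamp T)}.
  apply: continuous_max; first exact: cst_continuous.
  by apply: continuous_min; [exact: cvg_id|exact: cst_continuous].
have := cc _ hB; apply: (@filterS _ (nbhs t)) => s /=; apply.
by rewrite in_itv/= clamp_itv.
Qed.

Lemma is_RS_integral_by_parts f df g J t : 0 <= t ->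
  continuous g -> continuous df ->
  (forall x, 0 <= x <= t -> is_derive x 1 f (df x)) ->
  (forall x, 0 <= x <= t -> is_derive x 1 J (df x * g x)) ->
  is_RS_integral f g 0 t (f t * g t - J t - (f 0 * g 0 - J 0)).
Proof.
move=> t0 cg cdf hf hJ.
apply: (@is_RS_integral_sewing _ f g (fun x => f x * g x - J x) 0 t t0) => e e0.
have [M M0 hM] := segment_bounded 0 t cdf.
have eM : 0 < e / (M * 2) by rewrite divr_gt0// mulr_gt0.
have [dl dl0 hd] := segment_uniform_continuity 0 t cg eM.
exists dl => // x u v u0 vt /andP[ux xv] uv vu.
have piece c w z : u <= w -> w <= z -> z <= v -> u <= c <= v ->
    `|J z - g c * f z - (J w - g c * f w)| <= e / 2 * (z - w).
  move=> uw wz zv /andP[uc cv].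
  apply: (@ler_deriv_increment _ (fun s => J s - g c * f s)
    (fun s => df s * g s - g c * df s)) => // s /andP[ws sz].
    have st : 0 <= s <= t by apply/andP; split; lra.
    exact: (is_deriveB (hJ s st) (is_deriveZ (g c) (hf s st))).
  rewrite (_ : _ - _ = df s * (g s - g c)); last by ring.
  rewrite normrM (_ : e / 2 = M * (e / (M * 2))); last by field; lra.
  apply: ler_pM => //; first by apply: hM; apply/andP; split; lra.
  apply: hd; [by apply/andP; split; lra..|].
  by rewrite ltr_norml; apply/andP; split; lra.
have := piece v x v ux xv (lexx _); rewrite (ltW uv) lexx => /(_ erefl) h1.
have := piece u u x (lexx _) ux xv; rewrite (ltW uv) lexx => /(_ erefl) h2.
rewrite /RS_piece.
move: h1 h2; rewrite !ler_norml => /andP[? ?] /andP[? ?].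
by apply/andP; split; lra.
Qed.

Lemma expR_increment y z : expR z * (y - z) <= expR y - expR z.
Proof.
have := expR_ge1Dx (y - z); rewrite expRD expRN => h.
have z0 : 0 < expR z := expR_gt0 z.
by move: h; rewrite -(ler_pM2l z0) mulrCA divff ?gt_eqF// => h; lra.
Qed.

Lemma expR_taylor1 y z M : expR y <= M -> expR z <= M ->
  `|expR y - expR z - expR z * (y - z)| <= M * (y - z) ^+ 2.
Proof.
move=> yM zM.
have h1 := expR_increment y z; have h2 := expR_increment z y.
rewrite ger0_norm; last by lra.
apply: (@le_trans _ _ ((expR y - expR z) * (y - z))); first by lra.
rewrite expr2 mulrA; have [yz|zy] := leP z y.
  by apply: ler_wpM2r; nra.
by apply: ler_wnM2r; nra.
Qed.

End paths.

Section holder.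
Context {R : realType}.
Implicit Types (f g F A N X b phi : R -> R).
Implicit Types (s t u v x y z h T M C e K gamma beta sigma : R).

Definition holder_on T C gamma f : Prop := forall u v,
  0 <= u -> u <= v -> v <= T -> `|f v - f u| <= C * (v - u) `^ gamma.

Lemma holder_onS T T' C gamma f : T' <= T ->
  holder_on T C gamma f -> holder_on T' C gamma f.
Proof. by move=> TT h u v u0 uv vT; apply: h => //; exact: le_trans TT. Qed.

Lemma eq_holder_on T C gamma f g : (forall x, 0 <= x <= T -> f x = g x) ->
  holder_on T C gamma f -> holder_on T C gamma g.
Proof.
move=> fg h u v u0 uv vT.
by rewrite -!fg ?h// ?u0 ?vT ?(le_trans u0 uv) ?(le_trans uv vT).
Qed.

Lemma holder_onD T C C' gamma f g : holder_on T C gamma f ->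
  holder_on T C' gamma g -> holder_on T (C + C') gamma (fun s => f s + g s).
Proof.
move=> hf hg u v u0 uv vT; rewrite mulrDl.
apply: le_trans (lerD (hf u v u0 uv vT) (hg u v u0 uv vT)).
by rewrite opprD addrACA ler_normD.
Qed.

Lemma holder_onZ T C gamma sigma f : holder_on T C gamma f ->
  holder_on T (`|sigma| * C) gamma (fun s => sigma * f s).
Proof.
move=> hf u v u0 uv vT.
by rewrite -mulrBr normrM -mulrA ler_wpM2l// hf.
Qed.

Lemma derive_holder_on T gamma A phi : 0 < T -> 0 < gamma <= 1 ->
  continuous phi -> (forall x, 0 <= x <= T -> is_derive x 1 A (phi x)) ->
  exists2 C, 0 < C & holder_on T C gamma A.
Proof.
move=> T0 /andP[g0 g1] cphi dA.
have [M M0 hM] := segment_bounded 0 T cphi.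
exists (M * T `^ (1 - gamma)); first by rewrite mulr_gt0 ?powR_gt0.
move=> u v u0; rewrite le_eqVlt => /orP[/eqP <- _|uv vT].
  by rewrite !subrr normr0 powR0 ?gt_eqF// mulr0.
have vu : 0 < v - u by rewrite subr_gt0.
apply: (@le_trans _ _ (M * (v - u))).
  apply: (ler_deriv_increment (ltW uv)) => x /andP[ux xv].
    by apply: dA; rewrite (le_trans u0 ux) (le_trans xv vT).
  by apply: hM; rewrite (le_trans u0 ux) (le_trans xv vT).
rewrite -mulrA ler_pM2l//.
have vuE : v - u = (v - u) `^ (1 - gamma) * (v - u) `^ gamma.
  by rewrite -powRD ?subrK ?powRr1 ?ltW// (gt_eqF vu) implybT.
rewrite {1}vuE ler_wpM2r ?powR_ge0// ge0_ler_powR ?nnegrE//; lra.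
Qed.

Lemma holder_on_expR T C gamma f M :
  (forall x, 0 <= x <= T -> expR (f x) <= M) ->
  holder_on T C gamma f -> holder_on T (M * C) gamma (fun s => expR (f s)).
Proof.
move=> fM hf u v u0 uv vT.
have uM : expR (f u) <= M by apply: fM; rewrite u0 (le_trans uv vT).
have vM : expR (f v) <= M by apply: fM; rewrite vT (le_trans u0 uv).
apply: le_trans (_ : M * `|f v - f u| <= _); last first.
  by rewrite -mulrA ler_wpM2l ?hf// (le_trans (expR_ge0 (f u)) uM).
have h1 := expR_increment (f u) (f v); have h2 := expR_increment (f v) (f u).
have pu := expR_ge0 (f u); have pv := expR_ge0 (f v).
rewrite ler_norml; have [d|d] := leP 0 (f v - f u).
  rewrite (ger0_norm d); have q := ler_wpM2r d vM; have q' := mulr_ge0 pu d.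
  by apply/andP; split; lra.
rewrite (ltr0_norm d); have q := ler_wnM2r (ltW d) uM.
have q' := mulr_ge0_le0 pv (ltW d).
by apply/andP; split; lra.
Qed.

Lemma powR_sqr_small gamma K e : 2^-1 < gamma -> 0 <= K -> 0 < e ->
  exists2 dl, 0 < dl & forall h, 0 < h -> h < dl ->
    K * (h `^ gamma) ^+ 2 <= e * h.
Proof.
move=> g K0 e0.
have k0 : 0 < e / (K + 1) by rewrite divr_gt0//; lra.
have q0 : 0 < 2 * gamma - 1 by lra.
exists ((e / (K + 1)) `^ (2 * gamma - 1)^-1); first exact: powR_gt0.
move=> h h0 hd.
have hE : (h `^ gamma) ^+ 2 = h `^ (2 * gamma - 1) * h.
  rewrite -powR_mulrn ?powR_ge0// -powRrM mulrC.
  rewrite -[X in _ = _ * X]powRr1 ?ltW// -powRD ?subrK//.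
  by rewrite (gt_eqF h0) implybT.
have hk : h `^ (2 * gamma - 1) <= e / (K + 1).
  have -> : e / (K + 1) = (e / (K + 1)) `^ (2 * gamma - 1)^-1 `^ (2 * gamma - 1).
    by rewrite -powRrM mulVf ?gt_eqF// powRr1// ltW.
  by rewrite ge0_ler_powR ?nnegrE ?powR_ge0 ?ltW.
rewrite hE mulrA; apply: ler_wpM2r; first exact: ltW.
apply: le_trans (ler_wpM2l K0 hk) _.
by rewrite mulrCA ger_pMr// ler_pdivrMr ?mul1r; lra.
Qed.

(* Convexity bounds X_x (L_v - L_u) - (X_v - X_u), where L = ln X, by the squares
   of increments of L; these are o(v - u) because gamma > 1/2. *)
Lemma is_RS_integral_exp A phi N X b C gamma sigma t : 0 <= t -> sigma != 0 ->
  2^-1 < gamma -> 0 <= C -> continuous X -> continuous phi ->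
  holder_on t C gamma (fun s => A s + sigma * b s) ->
  (forall x, 0 <= x <= t -> X x = expR (A x + sigma * b x)) ->
  (forall x, 0 <= x <= t -> is_derive x 1 A (phi x)) ->
  (forall x, 0 <= x <= t -> is_derive x 1 N (X x * phi x)) ->
  is_RS_integral X b 0 t (sigma^-1 * (X t - N t) - sigma^-1 * (X 0 - N 0)).
Proof.
move=> t0 s0 g C0 cX cphi hL XE dA dN.
apply: (@is_RS_integral_sewing _ X b (fun x => sigma^-1 * (X x - N x)) 0 t t0) => e e0.
have [M M0 hM] := segment_bounded 0 t cX.
have [K K0 hK] := segment_bounded 0 t cphi.
pose e' := e * `|sigma| / 2.
have e'0 : 0 < e' by rewrite divr_gt0// mulr_gt0// normr_gt0.
have MC0 : 0 <= 2 * M * C ^+ 2 by rewrite !mulr_ge0 ?sqr_ge0// ltW.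
have [d1 d10 h1] := powR_sqr_small g MC0 e'0.
have [d2 d20 h2] := segment_uniform_continuity 0 t cX (divr_gt0 e'0 K0).
exists (Num.min d1 d2); first by rewrite lt_min d10.
move=> x u v u0 vt /andP[ux xv] uv; rewrite lt_min => /andP[vu1 vu2].
have xt : 0 <= x <= t by apply/andP; split; lra.
have ut : 0 <= u <= t by apply/andP; split; lra.
have vt' : 0 <= v <= t by apply/andP; split; lra.
have XM y : 0 <= y <= t -> expR (A y + sigma * b y) <= M.
  by move=> yt; rewrite -XE//; apply: le_trans (ler_norm _) (hM _ yt).
have taylor y z : 0 <= y <= t -> 0 <= z <= t -> `|y - z| <= v - u ->
    `|X y - X z - X z * (A y + sigma * b y - (A z + sigma * b z))|
      <= e' / 2 * (v - u).
  move=> yt zt yz.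
  rewrite !XE//; apply: le_trans (expR_taylor1 (XM y yt) (XM z zt)) _.
  have := h1 (v - u); rewrite subr_gt0 => /(_ uv vu1) h1'.
  suff : (A y + sigma * b y - (A z + sigma * b z)) ^+ 2 <=
         C ^+ 2 * (v - u) `^ gamma ^+ 2.
    by move=> q; have := ler_wpM2l (ltW M0) q; lra.
  rewrite -exprMn -[leLHS]real_normK ?num_real//.
  rewrite lerXn2r ?nnegrE ?mulr_ge0 ?powR_ge0//.
  have hyz : `|A y + sigma * b y - (A z + sigma * b z)| <= C * `|y - z| `^ gamma.
    move: yt zt => /andP[? ?] /andP[? ?].
    have [zy|yz'] := leP z y.
      by rewrite (@ger0_norm _ (y - z)) ?subr_ge0//; exact: hL.
    rewrite distrC (distrC y) (@ger0_norm _ (z - y)) ?subr_ge0; last exact: ltW.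
    by apply: hL => //; exact: ltW.
  apply: le_trans hyz _; rewrite ler_wpM2l// ge0_ler_powR ?nnegrE//; lra.
have sub : `|X x * A v - N v - (X x * A u - N u)| <= e' * (v - u).
  apply: (@ler_deriv_increment _ (fun s => X x * A s - N s)
    (fun s => X x * phi s - X s * phi s)) => [|s /andP[us sv]|s /andP[us sv]].
  - exact: ltW.
  - have st : 0 <= s <= t by apply/andP; split; lra.
    exact: (is_deriveB (is_deriveZ (X x) (dA s st)) (dN s st)).
  - have st : 0 <= s <= t by apply/andP; split; lra.
    rewrite -mulrBl normrM -(divfK (lt0r_neq0 K0) e').
    apply: ler_pM => //; last exact: hK.
    by apply: h2 => //; rewrite ltr_norml; apply/andP; split; lra.
have t1 : `|v - x| <= v - u by rewrite ger0_norm; lra.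
have t2 : `|u - x| <= v - u by rewrite ler0_norm; lra.
have {}t1 := taylor v x vt' xt t1; have {}t2 := taylor u x ut xt t2.
rewrite /RS_piece -(ler_pM2l (_ : 0 < `|sigma|)) ?normr_gt0//.
rewrite -normrM (_ : sigma * _ = X x * (sigma * (b v - b u)) - (X v - N v - (X u - N u)));
  last by field.
rewrite (_ : `|sigma| * _ = e' * 2 * (v - u)); last by rewrite /e'; field.
move: sub t1 t2; rewrite !ler_norml => /andP[? ?] /andP[? ?] /andP[? ?].
by apply/andP; split; lra.
Qed.

Lemma holder_on_CW T C gamma f : 0 < T -> 0 < gamma -> 0 <= C ->
  holder_on T C gamma f -> CW gamma^-1 0 T f.
Proof.
move=> T0 g0 C0 hf; have hf' x y : 0 <= x <= T -> 0 <= y <= T ->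
    `|f x - f y| <= C * `|x - y| `^ gamma.
  move=> /andP[? ?] /andP[? ?]; have [yx|xy] := leP y x.
    by rewrite (@ger0_norm _ (x - y)) ?subr_ge0//; exact: hf.
  rewrite distrC (distrC x) (@ger0_norm _ (y - x)) ?subr_ge0; last exact: ltW.
  by apply: hf => //; exact: ltW.
split.
  apply/subspace_continuousP => x; rewrite /= in_itv/= => xT.
  apply/cvgrPdist_le => e e0.
  have k0 : 0 < e / (C + 1) by rewrite divr_gt0//; lra.
  exists ((e / (C + 1)) `^ gamma^-1); first exact: powR_gt0.
  move=> y /= xy; rewrite in_itv/= => yT.
  apply: le_trans (hf' x y xT yT) _.
  have hk : `|x - y| `^ gamma <= e / (C + 1).
    have -> : e / (C + 1) = (e / (C + 1)) `^ gamma^-1 `^ gamma.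
      by rewrite -powRrM mulVf ?gt_eqF// powRr1// ltW.
    by rewrite ge0_ler_powR ?nnegrE ?powR_ge0//; exact: ltW.
  apply: le_trans (ler_wpM2l C0 hk) _.
  by rewrite mulrCA ger_pMr// ler_pdivrMr ?mul1r; lra.
exists (C `^ gamma^-1 * T) => _ [s /(pvariation_piece_sum (gamma^-1) f) [l hl ->] <-].
apply: le_trans (ler_piece_sum (w' := fun _ u v => C `^ gamma^-1 * (v - u)) _ hl) _.
  move=> x u v u0 vT _ uv _.
  apply: le_trans (_ : (C * (v - u) `^ gamma) `^ gamma^-1 <= _).
    rewrite ge0_ler_powR ?nnegrE ?mulr_ge0 ?powR_ge0 ?invr_ge0 ?hf//; exact: ltW.
  rewrite powRM ?powR_ge0// -powRrM divff ?gt_eqF// powRr1// subr_ge0; exact: ltW.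
by rewrite piece_sumZ (piece_sum_telescope id hl) /= subr0.
Qed.

End holder.

(** * The Gompertz equation along a path *)

Section gompertz_existence.
Context {R : realType}.
Variables (T alpha beta sigma x0 C gamma : R) (b : R -> R).
Hypotheses (T_gt0 : 0 < T) (beta_neq0 : beta != 0) (x0_gt0 : 0 < x0).
Hypotheses (gamma_itv : 2^-1 < gamma <= 1) (C_ge0 : 0 <= C).
Hypothesis b_cont : {within `[0, T], continuous b}.
Hypothesis b_holder : holder_on T C gamma b.

Let bT : R -> R := b \o clamp T.
Let bT_cont : continuous bT.
Proof. by apply: continuous_comp_clamp => //; exact: ltW. Qed.

Let bTE (x : R) : 0 <= x <= T -> bT x = b x.
Proof. by move=> xT; rewrite /bT /= clamp_id. Qed.

Let is_derive_expRM (k x : R) :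
  is_derive x 1 (fun s => expR (k * s)) (k * expR (k * x)).
Proof.
rewrite mulrC; apply: is_derive1_comp.
by have := is_deriveZ k (is_derive_id x (1 : R)); rewrite scaler1.
Qed.

Let continuous_expRM (k : R) : continuous (fun s => expR (k * s)).
Proof.
move=> x; apply: continuous_comp; last exact: continuous_expR.
by apply: cvgM; [exact: cvg_cst|exact: cvg_id].
Qed.

Let weight_cont : continuous (fun s => beta * expR (beta * s) * bT s).
Proof.
move=> x; apply: cvgM; last exact: bT_cont.
by apply: cvgM; [exact: cvg_cst|exact: continuous_expRM].
Qed.

Let primJ := primitive_exists weight_cont.

Let J : R -> R := s2val (cid2 primJ).

Let dJ (x : R) : 0 <= x -> is_derive x 1 J (beta * expR (beta * x) * bT x).
Proof. by rewrite /J; case: (cid2 primJ) => F /= dF _; exact: dF. Qed.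

Let Int (t : R) := b t - expR (- beta * t) * (b 0 + (J t - J 0)).

Let is_RS_integral_kernel (t : R) : 0 <= t <= T ->
  is_RS_integral (gompertz_kernel beta t) b 0 t (Int t).
Proof.
move=> /andP[t0 tT].
have kE s : gompertz_kernel beta t s = expR (- beta * t) * expR (beta * s).
  by rewrite /gompertz_kernel -expRD; congr expR; ring.
apply: (@eq_is_RS_integral _ (fun s => expR (- beta * t) * expR (beta * s)) _ bT).
- by move=> x _; rewrite kE.
- by move=> x /andP[x0' xt]; rewrite (bTE (x := x))// x0' (le_trans xt tT).
have := @is_RS_integral_by_parts R (fun s => expR (- beta * t) * expR (beta * s))
  (fun s => expR (- beta * t) * (beta * expR (beta * s))) bT
  (fun s => expR (- beta * t) * J s) t t0 bT_cont.
rewrite (_ : _ - _ = Int t); last first.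
  rewrite /Int !bTE ?lexx ?t0 ?tT ?ltW// mulr0 expR0.
  have : expR (- beta * t) * expR (beta * t) = 1.
    by rewrite -expRD (_ : _ + _ = 0) ?expR0//; ring.
  by move=> ->; ring.
apply.
- move=> x; apply: cvgM; first exact: cvg_cst.
  by apply: cvgM; [exact: cvg_cst|exact: continuous_expRM].
- by move=> x _; exact: (is_deriveZ _ (is_derive_expRM beta x)).
- move=> x /andP[x0' _]; rewrite -mulrA.
  exact: (is_deriveZ _ (dJ x0')).
Qed.

(* ln X = A + sigma b, where A is differentiable with A' = alpha - beta ln X. *)
Let A (t : R) := expR (- beta * t) * ln x0 + alpha / beta * (1 - expR (- beta * t))
  - sigma * (expR (- beta * t) * (b 0 + (J t - J 0))).

Let L (t : R) := A t + sigma * b t.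

Definition gompertz_sol (t : R) := expR (expR (- beta * t) * ln x0
  + alpha / beta * (1 - expR (- beta * t))
  + sigma * RS_integral (gompertz_kernel beta t) b 0 t).

Let gompertz_solE (t : R) : 0 <= t <= T -> gompertz_sol t = expR (L t).
Proof.
move=> tT; have /andP[t0 _] := tT.
rewrite /gompertz_sol (RS_integral_val t0 (is_RS_integral_kernel tT)).
by congr expR; rewrite /L /A /Int; ring.
Qed.

Let dA (t : R) : 0 <= t <= T -> is_derive t 1 A (alpha - beta * L t).
Proof.
move=> /andP[t0 tT].
have dE := is_derive_expRM (- beta) t.
have d1 := is_deriveM dE (is_derive_cst (ln x0) t (1 : R)).
have d2 := is_deriveZ (alpha / beta) (is_deriveB (is_derive_cst (1 : R) t (1 : R)) dE).
have d3 := is_deriveZ sigma (is_deriveM dE (is_deriveD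
  (is_derive_cst (b 0) t (1 : R)) (is_deriveB (dJ t0) (is_derive_cst (J 0) t (1 : R))))).
apply: (@is_derive_eq _ _ _ _ _ _ _ _ (is_deriveB (is_deriveD d1 d2) d3)) => /=.
rewrite !fctE /GRing.scale /= /L /A bTE ?t0//.
have h : expR (- beta * t) * expR (beta * t) = 1.
  by rewrite -expRD (_ : _ + _ = 0) ?expR0//; ring.
transitivity (alpha - beta * (expR (- beta * t) * ln x0
    + alpha / beta * (1 - expR (- beta * t))
    - sigma * (expR (- beta * t) * (b 0 + (J t - J 0))))
  - beta * sigma * b t * (expR (- beta * t) * expR (beta * t)));
  last by rewrite h; ring.
by field.
Qed.

Let LT : R -> R := L \o clamp T.

Let LT_cont : continuous LT.
Proof.
move=> x; apply: cvgD; last by apply: cvgM; [exact: cvg_cst|exact: bT_cont].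
apply: (continuous_comp_clamp (ltW T_gt0)).
apply: derivable_within_continuous => y; rewrite in_itv/= => yT.
by have [] := dA yT.
Qed.

Let LTE (x : R) : 0 <= x <= T -> LT x = L x.
Proof. by move=> xT; rewrite /LT /= clamp_id. Qed.

Let phi (t : R) := alpha - beta * LT t.
Let phi_cont : continuous phi.
Proof.
move=> x; apply: cvgB; first exact: cvg_cst.
by apply: cvgM; [exact: cvg_cst|exact: LT_cont].
Qed.

Let X (t : R) := expR (LT t).
Let X_cont : continuous X.
Proof. by move=> x; apply: continuous_comp; [exact: LT_cont|exact: continuous_expR]. Qed.

Let XE (x : R) : 0 <= x <= T -> X x = gompertz_sol x.
Proof. by move=> xT; rewrite /X (LTE xT) gompertz_solE. Qed.

Let dAphi (x : R) : 0 <= x <= T -> is_derive x 1 A (phi x).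
Proof.
move=> xT; have -> : phi x = alpha - beta * L x by rewrite /phi (LTE xT).
exact: dA.
Qed.

Let Xphi_cont : continuous (fun s => X s * phi s).
Proof. by move=> x; apply: cvgM; [exact: X_cont|exact: phi_cont]. Qed.

Let L_holder : exists2 K, 0 <= K & holder_on T K gamma L.
Proof.
have [|M M0 hM] := derive_holder_on T_gt0 _ phi_cont dAphi (gamma := gamma).
  by case/andP: gamma_itv => ? ->; rewrite andbT; lra.
exists (M + `|sigma| * C); first by rewrite addr_ge0 ?mulr_ge0// ltW.
exact: holder_onD hM (holder_onZ sigma b_holder).
Qed.

Lemma gompertz_kernel_integrable (t : R) : 0 <= t <= T ->
  RS_integrable (gompertz_kernel beta t) b 0 t.
Proof. by move=> tT; exists (Int t); exact: is_RS_integral_kernel. Qed.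

Lemma gompertz_sol_CW : CW gamma^-1 0 T gompertz_sol.
Proof.
have [K K0 hK] := L_holder; have [M M0 hM] := segment_bounded 0 T X_cont.
apply: (@holder_on_CW _ T (M * K) gamma) => //.
- by case/andP: gamma_itv => ? _; lra.
- by rewrite mulr_ge0// ltW.
apply: (eq_holder_on (f := fun s => expR (L s))).
  by move=> x xT; rewrite gompertz_solE.
apply: holder_on_expR hK => x xT; rewrite -(LTE xT).
by apply: le_trans (ler_norm _) (hM x xT).
Qed.

Lemma gompertz_sol_path : gompertz_path T alpha beta sigma x0 b gompertz_sol.
Proof.
move=> t tT; have /andP[t0 t_leT] := tT.
have sub x : 0 <= x <= t -> 0 <= x <= T.
  by move=> /andP[-> xt]; rewrite (le_trans xt).
have OT : 0 <= (0 : R) <= T by rewrite lexx ltW.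
have X0E : X 0 = x0.
  rewrite (XE OT) /gompertz_sol mulr0 expR0 subrr mulr0 addr0 mul1r.
  rewrite (@RS_integral_val _ _ _ 0 0 (b 0 - expR (- beta * 0) * (b 0 + (J 0 - J 0))))//.
    by rewrite mulr0 expR0 mul1r subrr addr0 subrr mulr0 addr0 lnK.
  exact: is_RS_integral_kernel.
have [N dN NE] := primitive_exists Xphi_cont.
have intE : \int[lebesgue_measure]_(s in `[0, t])
    (alpha * gompertz_sol s - beta * gompertz_sol s * ln (gompertz_sol s)) = N t - N 0.
  rewrite -NE//; apply: eq_Rintegral => s; rewrite inE/= in_itv/= => /sub sT.
  by rewrite -(XE sT) /X expRK /phi; ring.
have solX f I : is_RS_integral X b 0 t I -> f = sigma * I ->
    X t = x0 + (N t - N 0) + f -> [/\ 0 < gompertz_sol t,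
      RS_integrable gompertz_sol b 0 t & gompertz_sol t = x0 + (N t - N 0) +
        sigma * RS_integral gompertz_sol b 0 t].
  move=> hI fE Xt.
  have hI' : is_RS_integral gompertz_sol b 0 t I.
    by apply: eq_is_RS_integral hI => // x /sub xT; rewrite (XE xT).
  rewrite (RS_integral_val t0 hI') -fE -(XE tT).
  by split => //; [exact: expR_gt0|exists I].
rewrite intE; have [s0|s0] := eqVneq sigma 0.
  have XA x : 0 <= x <= T -> X x = expR (A x).
    by move=> xT; rewrite /X (LTE xT) /L s0 mul0r addr0.
  have dX x : 0 <= x <= T -> is_derive x 1 (fun s => expR (A s)) (X x * phi x).
    move=> xT; rewrite (XA x xT).
    exact: (is_derive1_comp (is_derive_expR (A x)) (dAphi xT)).
  have Xphib_cont : continuous (fun s => X s * phi s * bT s).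
    by move=> x; apply: cvgM; [exact: Xphi_cont|exact: bT_cont].
  have [J' dJ' _] := primitive_exists Xphib_cont.
  have := @is_RS_integral_by_parts R _ _ bT J' t t0 bT_cont Xphi_cont
    (fun x xt => dX x (sub x xt)).
  move=> /(_ _)/wrap[x /andP[x0' _]|hI]; first exact: dJ'.
  apply: (@solX 0 _ (eq_is_RS_integral _ _ hI)).
  - by move=> x /sub xT; rewrite (XA x xT).
  - by move=> x /sub xT; rewrite (bTE xT).
  - by rewrite s0 mul0r.
  have := @ler_deriv_increment R (fun s => expR (A s) - N s)
    (fun s => X s * phi s - X s * phi s) 0 t 0 t0.
  rewrite mul0r normr_le0 -(XA t tT) -(XA 0 OT) X0E addr0 => h.
  suff /eqP : X t - N t - (x0 - N 0) == 0 by lra.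
  apply: h => x xt; last by rewrite subrr normr0.
  by have /andP[x0' _] := xt; exact: (is_deriveB (dX x (sub x xt)) (dN x x0')).
have [K K0 hK] := L_holder.
have [g _] := andP gamma_itv.
have hI : is_RS_integral X b 0 t (sigma^-1 * (X t - N t) - sigma^-1 * (X 0 - N 0)).
  have XL x : 0 <= x <= t -> X x = expR (A x + sigma * b x).
    by move=> /sub xT; rewrite /X (LTE xT).
  have dA' x : 0 <= x <= t -> is_derive x 1 A (phi x) by move=> /sub /dAphi.
  have dN' x : 0 <= x <= t -> is_derive x 1 N (X x * phi x).
    by move=> /andP[/dN].
  exact: (is_RS_integral_exp t0 s0 g K0 X_cont phi_cont (holder_onS t_leT hK) XL dA' dN').
apply: (solX _ _ hI erefl); rewrite X0E; field.
by rewrite s0.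
Qed.

End gompertz_existence.

Section gompertz_uniqueness.
Context {R : realType}.
Variables (T alpha beta sigma x0 p : R) (b : R -> R).
Hypotheses (T_gt0 : 0 < T) (p_itv : 0 < p < 2).

Let sqr_le_powR (h e : R) : 0 < e -> `|h| <= Num.min e (e `^ (2 - p)^-1) ->
  h ^+ 2 <= e * `|h| `^ p.
Proof.
case/andP: p_itv => p0 p2 e0; rewrite le_min => /andP[_ he].
have q0 : 0 < 2 - p by lra.
have [->|h0] := eqVneq h 0.
  by rewrite expr0n/= mulr_ge0// ?ltW// powR_ge0.
rewrite -real_normK ?num_real// -powR_mulrn//.
rewrite (_ : 2%:R = 2 - p + p); last by rewrite subrK.
rewrite powRD; last by rewrite normr_eq0 h0 implybT.
rewrite ler_wpM2r ?powR_ge0//.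
have -> : e = e `^ (2 - p)^-1 `^ (2 - p).
  by rewrite -powRrM mulVf ?gt_eqF// powRr1// ltW.
by rewrite ge0_ler_powR ?nnegrE ?powR_ge0//; exact: ltW.
Qed.

Let le0_of_le_mul (c Z : R) : 0 <= Z -> (forall e, 0 < e -> c <= e * Z) -> c <= 0.
Proof.
move=> Z0 h; rewrite leNgt; apply/negP => c0.
have Z1 : 0 < Z + 1 by lra.
have k0 : 0 < c / (Z + 1) by rewrite divr_gt0.
have := h _ k0; apply/negP; rewrite -ltNge mulrAC ltr_pdivrMr// ltr_pM2l//.
by rewrite ltrDl.
Qed.

(* The Saks-Henstock lemma allows multiplying the local errors of the integral of
   y against b by 1/y, and the quadratic variation of y vanishes as p < 2, so
   that ln y obeys the ordinary chain rule. *)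
Lemma gompertz_path_ln y : CW p 0 T y ->
  gompertz_path T alpha beta sigma x0 b y ->
  exists Phi : R -> R,
    (forall t, 0 <= t <= T -> is_derive t 1 Phi (alpha - beta * ln (y t))) /\
    (forall t, 0 <= t <= T ->
      ln (y t) = ln x0 + (Phi t - Phi 0) + sigma * (b t - b 0)).
Proof.
move=> [cy [V hV]] hy.
pose yT : R -> R := y \o clamp T.
have yT_cont : continuous yT by apply: continuous_comp_clamp cy; exact: ltW.
have yTE (x : R) : 0 <= x <= T -> yT x = y x.
  by move=> xT; rewrite /yT /= clamp_id.
have yT_gt0 x : 0 < yT x by have [] := hy _ (clamp_itv x (ltW T_gt0)).
pose u x := ln (yT x).
have expu x : expR (u x) = yT x by rewrite /u lnK ?posrE.
have u_cont : continuous u.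
  by move=> x; apply: continuous_comp; [exact: yT_cont|exact: continuous_ln].
pose phi x := alpha - beta * u x.
have phi_cont : continuous phi.
  move=> x; apply: cvgB; first exact: cvg_cst.
  by apply: cvgM; [exact: cvg_cst|exact: u_cont].
have yphi_cont : continuous (fun x => yT x * phi x).
  by move=> x; apply: cvgM; [exact: yT_cont|exact: phi_cont].
have [Phi dPhi _] := primitive_exists phi_cont.
have [N dN NE] := primitive_exists yphi_cont.
exists Phi; split=> [t tT|t tT].
  have /andP[t0 _] := tT; have := dPhi t t0.
  by rewrite /phi /u (yTE t tT).
have /andP[t0 t_leT] := tT.
pose F s := RS_integral y b 0 s.
have yE s : 0 <= s <= T -> y s = x0 + (N s - N 0) + sigma * F s.
  move=> sT; have [_ _ ->] := hy s sT; have /andP[s0 s_leT] := sT.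
  congr (_ + _ + _); rewrite -NE//; apply: eq_Rintegral => z.
  rewrite inE/= in_itv/= => /andP[z0 zs].
  have zT : 0 <= z <= T by rewrite z0 (le_trans zs).
  by rewrite /phi /u (yTE z zT); ring.
have OT : 0 <= (0 : R) <= T by rewrite lexx ltW.
have y0 : y 0 = x0.
  rewrite (yE _ OT) /F (RS_integral_val _ (is_RS_integral_point _ _ _))//.
  by rewrite subrr mulr0 !addr0.
have [U U0 hU] := segment_bounded 0 T u_cont.
have [K K0 hK] := segment_bounded 0 T phi_cont.
pose M := expR U; pose m := expR (- U).
have m0 : 0 < m := expR_gt0 _.
have M0 : 0 < M := expR_gt0 _.
have yM x : 0 <= x <= T -> m <= yT x <= M.
  move=> /hU; rewrite ler_norml -expu /m /M !ler_expR => /andP[-> ->] //.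
have V0 : 0 <= V.
  have [l hl] := tagged_partition_exists (ltr01 : 0 < 1 :> R) (ltW T_gt0).
  have [pl _ _] := tagged_partition_unzip hl.
  apply: le_trans (hV _ (ex_intro2 _ _ _ pl erefl)).
  by rewrite /pvariation sumr_ge0// => i _; exact: powR_ge0.
pose Q := u t - u 0 - (Phi t - Phi 0) - sigma * (b t - b 0).
suff : `|m * Q| <= 0.
  rewrite normr_le0 mulf_eq0 (gt_eqF m0) /Q /u (yTE t tT) (yTE 0 OT) y0 => /eqP; lra.
have Z0 : 0 <= M / m ^+ 2 * V + K * T + `|sigma|.
  by rewrite !addr_ge0// mulr_ge0//; [rewrite divr_ge0 ?sqr_ge0//| |]; exact: ltW.
apply: (le0_of_le_mul Z0) => e e0.
have eta0 : 0 < Num.min e (e `^ (2 - p)^-1) by rewrite lt_min e0 powR_gt0.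
have [d1 d10 h1] := segment_uniform_continuity 0 T yT_cont eta0.
have [d2 d20 h2] := saks_henstock (fun s sT => let: And3 _ h _ := hy s sT in h) tT e0.
have d0 : 0 < Num.min d1 d2 by rewrite lt_min d10.
have [l hl lw] := left_tagged_partition_exists d0 t0.
have {h2} : piece_sum (fun _ a c => `|F c - F a - y a * (b c - b a)|) 0 l <= e.
  rewrite -(lw (fun x a c => `|F c - F a - y x * (b c - b a)|)).
  by apply: h2; apply: tagged_partition_widen hl; rewrite ge_min lexx orbT.
have QE : Q = piece_sum (fun _ a c =>
    u c - u a - (Phi c - Phi a) - sigma * (b c - b a)) 0 l.
  transitivity (piece_sum (fun _ a c => (u c - Phi c - sigma * b c)
      - (u a - Phi a - sigma * b a)) 0 l).
    rewrite (piece_sum_telescope (fun s => u s - Phi s - sigma * b s) hl).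
    by rewrite /Q; ring.
  by apply: eq_piece_sum hl => *; ring.
have pV : piece_sum (fun _ a c => `|yT c - yT a| `^ p) 0 l <= V.
  have [l2 hl2 _] := left_tagged_partition_exists d0 t_leT.
  have hl' := tagged_partition_cat hl hl2.
  have [pl _ _] := tagged_partition_unzip hl'.
  apply: le_trans (hV _ (ex_intro2 _ _ _ pl erefl)).
  rewrite pvariation_unzip (piece_sum_cat _ _ hl).
  rewrite (@eq_piece_sum _ _ (fun _ a c => `|y c - y a| `^ p) _ _ _ _ _ hl).
    rewrite lerDl.
    have : piece_sum (fun _ a c => 0 * (c - a)) t l2 <=
       piece_sum (fun _ a c => `|y c - y a| `^ p) t l2.
      by apply: ler_piece_sum hl2 => *; rewrite mul0r powR_ge0.
    by rewrite piece_sumZ mul0r.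
  move=> x a c a0 ct /andP[ax xc] _ _; rewrite !yTE//; apply/andP; split; lra.
move=> pSH; rewrite QE -piece_sumZ.
apply: le_trans (piece_sum_norm _ _ _) _.
apply: le_trans (ler_piece_sum (w' := fun _ a c =>
   e * (M / m ^+ 2) * `|yT c - yT a| `^ p + (e * K) * (c - a)
   + `|sigma| * `|F c - F a - y a * (b c - b a)|) _ hl) _; last first.
  rewrite !piece_sumD !piece_sumZ (piece_sum_telescope id hl) /= subr0.
  rewrite !mulrDr -!mulrA; apply: lerD; first apply: lerD.
  - by rewrite !ler_pM2l ?invr_gt0 ?exprn_gt0//.
  - by rewrite !ler_pM2l//.
  - by rewrite [leRHS]mulrC ler_wpM2l.
move=> x a c a0 ct _ ac ca.
have aT : 0 <= a <= T by apply/andP; split; lra.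
have cT : 0 <= c <= T by apply/andP; split; lra.
have /andP[ma aM] := yM a aT; have /andP[mc cM] := yM c cT.
have dy : `|yT c - yT a| <= Num.min e (e `^ (2 - p)^-1).
  apply: h1 => //; rewrite ger0_norm ?subr_ge0 ?ltW//.
  by apply: lt_le_trans ca _; rewrite ge_min lexx.
have step1 : `|yT c - yT a - yT a * (u c - u a)| <=
    e * (M / m ^+ 2) * `|yT c - yT a| `^ p.
  have := @expR_taylor1 R (u c) (u a) M; rewrite !expu => /(_ cM aM) hE.
  apply: (le_trans hE).
  rewrite (_ : e * _ * _ = M * (m ^- 2 * (e * `|yT c - yT a| `^ p))); last by ring.
  rewrite ler_pM2l// mulrC ler_pdivlMr ?exprn_gt0//.
  apply: le_trans (sqr_le_powR e0 dy).
  rewrite -exprMn -[leLHS]real_normK ?num_real// -[leRHS]real_normK ?num_real//.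
  rewrite lerXn2r ?nnegrE// normrM (gtr0_norm m0).
  have k1 := expR_increment (u c) (u a); have k2 := expR_increment (u a) (u c).
  rewrite !expu in k1 k2.
  have [d|d] := leP 0 (u c - u a).
    have q := ler_wpM2r d ma.
    by apply: le_trans (ler_norm _); rewrite (ger0_norm d) mulrC; lra.
  have q := ler_wnM2r (ltW d) mc.
  rewrite [leRHS]distrC; apply: le_trans (ler_norm _).
  by rewrite (ltr0_norm d) mulNr mulrC; lra.
have step2 : `|N c - N a - yT a * (Phi c - Phi a)| <= e * K * (c - a).
  rewrite (_ : N c - _ - _ = N c - yT a * Phi c - (N a - yT a * Phi a)); last by ring.
  apply: (@ler_deriv_increment _ (fun s => N s - yT a * Phi s)
    (fun s => yT s * phi s - yT a * phi s)) => [|s /andP[as_ sc]|s /andP[as_ sc]].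
  - exact: ltW.
  - have s0 : 0 <= s := le_trans a0 as_.
    exact: (is_deriveB (dN s s0) (is_deriveZ (yT a) (dPhi s s0))).
  - have sT : 0 <= s <= T.
      by rewrite (le_trans a0 as_) (le_trans sc (le_trans ct t_leT)).
    rewrite -mulrBl normrM; apply: ler_pM => //; last exact: hK.
    apply: le_trans (_ : Num.min e (e `^ (2 - p)^-1) <= e); last by rewrite ge_min lexx.
    apply: h1 => //; rewrite ger0_norm ?subr_ge0//.
    apply: le_lt_trans (lt_le_trans ca _); last by rewrite ge_min lexx.
    by rewrite lerB.
have step3 : yT c - yT a = N c - N a + sigma * (F c - F a).
  by rewrite (yTE c cT) (yTE a aT) (yE c cT) (yE a aT); ring.
rewrite normrM (gtr0_norm m0).
have ya0 : 0 < yT a := lt_le_trans m0 ma.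
apply: le_trans (ler_wpM2r (normr_ge0 _) ma) _.
rewrite -[X in X * _](gtr0_norm ya0) -normrM -(yTE a aT).
rewrite (_ : yT a * (u c - _ - _ - _) = - (yT c - yT a - yT a * (u c - u a)) +
  (N c - N a - yT a * (Phi c - Phi a)) +
  sigma * (F c - F a - yT a * (b c - b a))); last by rewrite step3; ring.
apply: le_trans (ler_normD _ _) (lerD _ _); last by rewrite normrM.
by apply: le_trans (ler_normD _ _) (lerD _ step2); rewrite normrN.
Qed.

Lemma gompertz_path_unique y z : CW p 0 T y -> CW p 0 T z ->
  gompertz_path T alpha beta sigma x0 b y ->
  gompertz_path T alpha beta sigma x0 b z ->
  forall t, 0 <= t <= T -> y t = z t.
Proof.
move=> cy cz hy hz t tT; have /andP[t0 t_leT] := tT.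
have [Phi [dPhi lny]] := gompertz_path_ln cy hy.
have [Psi [dPsi lnz]] := gompertz_path_ln cz hz.
have dE s : 0 <= s <= t -> is_derive s 1
    (fun s => expR (beta * s) * (Phi s - Psi s - (Phi 0 - Psi 0))) 0.
  move=> /andP[s0 st]; have sT : 0 <= s <= T by rewrite s0 (le_trans st).
  have d1 : is_derive s 1 (fun s => expR (beta * s)) (beta * expR (beta * s)).
    rewrite mulrC; apply: is_derive1_comp.
    by have := is_deriveZ beta (is_derive_id s (1 : R)); rewrite scaler1.
  apply: (@is_derive_eq _ _ _ _ _ _ _ _ (is_deriveM d1 (is_deriveB
    (is_deriveB (dPhi s sT) (dPsi s sT))
    (is_derive_cst (Phi 0 - Psi 0) s (1 : R))))) => /=.
  by rewrite !fctE /GRing.scale /= (lny s sT) (lnz s sT); ring.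
have := @ler_deriv_increment R _ (fun=> 0) 0 t 0 t0 dE.
have hn (s : R) : 0 <= s <= t -> `|0 : R| <= 0 by rewrite normr0.
move=> /(_ hn); rewrite mul0r normr_le0 subrr mulr0 subr0.
rewrite mulf_eq0 gt_eqF ?expR_gt0//= => /eqP PhiPsi.
have [y0 _ _] := hy t tT; have [z0 _ _] := hz t tT.
by apply: ln_inj; rewrite ?posrE// (lny t tT) (lnz t tT); lra.
Qed.

End gompertz_uniqueness.

(** * Regularity of fractional Brownian motion *)

Section dyadic_chaining.
Context {R : realType}.
Variables (T K q : R) (f : R -> R).
Hypotheses (T_gt0 : 0 < T) (K_ge0 : 0 <= K) (q_itv : 0 < q < 1).
Hypothesis f_cont : continuous f.

Definition dyadic (T : R) (n k : nat) : R := T * (k%:R / 2 ^+ n).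

Hypothesis f_inc : forall n k, (k < 2 ^ n)%N ->
  `|f (dyadic T n k.+1) - f (dyadic T n k)| <= K * q ^+ n.

Let idx n (t : R) := Num.truncn (t / T * 2 ^+ n).
Let rnd n (t : R) := dyadic T n (idx n t).

Let pow2_gt0 n : 0 < 2 ^+ n :> R. Proof. exact: exprn_gt0. Qed.

Let idx_itv n t : 0 <= t -> (idx n t)%:R <= t / T * 2 ^+ n < (idx n t).+1%:R.
Proof.
move=> t0; apply: truncn_itv.
by rewrite mulr_ge0// ?divr_ge0 ?(ltW T_gt0) ?(ltW (pow2_gt0 n)).
Qed.

Let scaled_le n t : t <= T -> t / T * 2 ^+ n <= 2 ^+ n.
Proof. by move=> tT; rewrite ger_pMl// ler_pdivrMr ?mul1r. Qed.

Let dyadic_double n k : dyadic T n.+1 k.*2 = dyadic T n k.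
Proof.
rewrite /dyadic -muln2 natrM exprS; field.
by rewrite gt_eqF.
Qed.

Let step n t : 0 <= t <= T -> `|f (rnd n.+1 t) - f (rnd n t)| <= K * q ^+ n.+1.
Proof.
move=> /andP[t0 tT].
have /andP[a1 a2] := idx_itv n t0.
have x2 : t / T * 2 ^+ n.+1 = 2 * (t / T * 2 ^+ n) by rewrite exprS; ring.
have dbl : (idx n t).*2%:R = 2 * (idx n t)%:R :> R by rewrite -muln2 natrM mulrC.
have dbl1 : (idx n t).*2.+1%:R = 2 * (idx n t)%:R + 1 :> R by rewrite -dbl natr1.
have dbl2 : (idx n t).*2.+2%:R = 2 * (idx n t)%:R + 2 :> R.
  by rewrite -addn2 natrD dbl.
rewrite -natr1 in a2.
have [h|h] := leP ((idx n t).*2.+1%:R) (t / T * 2 ^+ n.+1).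
  have E : idx n.+1 t = (idx n t).*2.+1.
    by apply: truncn_def; rewrite h dbl2 x2; lra.
  rewrite /rnd E -(dyadic_double n (idx n t)); apply: f_inc.
  by rewrite -(ler_nat R) natrX; exact: le_trans h (scaled_le _ tT).
have E : idx n.+1 t = (idx n t).*2.
  by apply: truncn_def; rewrite h andbT dbl x2; lra.
rewrite /rnd E dyadic_double subrr normr0.
by case/andP: q_itv => q0 _; rewrite mulr_ge0// exprn_ge0// ltW.
Qed.

Let q1_gt0 : 0 < 1 - q. Proof. by case/andP: q_itv => _; rewrite subr_gt0. Qed.

Let steps n m t : 0 <= t <= T ->
  `|f (rnd (n + m) t) - f (rnd n t)| <= K * ((q ^+ n.+1 - q ^+ (n + m).+1) / (1 - q)).
Proof.
move=> tT; elim: m => [|m IH]; first by rewrite addn0 !subrr normr0 mul0r mulr0.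
apply: le_trans (ler_distD (f (rnd (n + m) t)) _ _) _.
rewrite addnS; apply: le_trans (lerD (step _ tT) IH) _.
rewrite -mulrDr ler_wpM2l// le_eqVlt; apply/orP; left; apply/eqP.
rewrite (exprS q (n + m).+1); field.
by rewrite gt_eqF.
Qed.

Let rnd_close n t : 0 <= t <= T -> `|t - rnd n t| <= T / 2 ^+ n.
Proof.
move=> /andP[t0 tT]; have /andP[a1 a2] := idx_itv n t0.
have -> : t - rnd n t = T / 2 ^+ n * (t / T * 2 ^+ n - (idx n t)%:R).
  by rewrite /rnd /dyadic; field; rewrite !gt_eqF.
rewrite normrM [X in X * _]ger0_norm ?divr_ge0 ?(ltW T_gt0)//.
rewrite ger_pMr ?divr_gt0// ger0_norm ?subr_ge0//.
by move: a2; rewrite -natr1; lra.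
Qed.

Let rnd_itv n t : 0 <= t <= T -> 0 <= rnd n t <= T.
Proof.
move=> /andP[t0 tT]; have /andP[a1 a2] := idx_itv n t0.
rewrite /rnd /dyadic mulr_ge0 ?(ltW T_gt0) ?divr_ge0//=.
by rewrite ger_pMr// ler_pdivrMr// mul1r (le_trans a1)// scaled_le.
Qed.

Let tail n t : 0 <= t <= T ->
  `|f t - f (rnd n t)| <= K * (q ^+ n.+1 / (1 - q)).
Proof.
move=> tT; apply/ler_addgt0Pr => e e0.
have [dl d0 hd] := segment_uniform_continuity 0 T f_cont e0.
have [m hm] : exists m, T / 2 ^+ m < dl.
  exists (Num.bound (T / dl)); rewrite ltr_pdivrMr// mulrC -ltr_pdivrMr//.
  apply: lt_trans (archi_boundP _) _; first by rewrite divr_ge0 ?ltW.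
  by rewrite -natrX ltr_nat ltn_expl.
have tm : T / 2 ^+ (n + m) <= T / 2 ^+ m.
  rewrite ler_pM2l// lef_pV2 ?posrE// exprD ler_pMl//.
  by rewrite exprn_ege1// ler1n.
apply: le_trans (ler_distD (f (rnd (n + m) t)) _ _) _.
rewrite addrC lerD//.
  apply: le_trans (steps n m tT) _; rewrite ler_wpM2l// ler_pM2r ?invr_gt0//.
  by case/andP: q_itv => q0 _; rewrite gerBl exprn_ge0// ltW.
apply: hd => //; first exact: rnd_itv.
by apply: le_lt_trans (rnd_close _ tT) (le_lt_trans tm hm).
Qed.

Let adjacent n s t : 0 <= s -> s <= t -> t <= T -> t - s <= T / 2 ^+ n ->
  `|f (rnd n t) - f (rnd n s)| <= K * q ^+ n.
Proof.
move=> s0 st tT ts; have t0 := le_trans s0 st.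
have /andP[a1 a2] := idx_itv n s0; have /andP[b1 b2] := idx_itv n t0.
have le1 : (idx n s <= idx n t)%N.
  by apply: le_truncn; rewrite ler_pM2r// ler_pM2r ?invr_gt0.
have le2 : (idx n t <= (idx n s).+1)%N.
  rewrite -ltnS -(ltr_nat R) -natr1; apply: le_lt_trans b1 _.
  have : t / T * 2 ^+ n - s / T * 2 ^+ n <= 1.
    rewrite -mulrBl -mulrBl -ler_pdivlMr// mul1r ler_pdivrMr//.
    by rewrite mulrC.
  by lra.
move: le2; rewrite leq_eqVlt => /orP[/eqP E|].
  rewrite /rnd E; apply: f_inc; rewrite -(ler_nat R) natrX -E.
  exact: le_trans b1 (scaled_le _ tT).
rewrite ltnS => le2; have E : idx n t = idx n s.
  by apply/eqP; rewrite eqn_leq le2.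
rewrite /rnd E subrr normr0.
by case/andP: q_itv => q0 _; rewrite mulr_ge0// exprn_ge0// ltW.
Qed.

Lemma dyadic_chaining : exists2 C, 0 <= C & forall s t n,
  0 <= s -> s <= t -> t <= T -> t - s <= T / 2 ^+ n ->
  `|f t - f s| <= C * q ^+ n.
Proof.
have [q0 _] := andP q_itv.
exists (K * (2 * q / (1 - q) + 1)).
  rewrite mulr_ge0// addr_ge0// divr_ge0//; last exact: ltW.
  by rewrite mulr_ge0// ltW.
move=> s t n s0 st tT ts.
have h1 := tail n (introT andP (conj (le_trans s0 st) tT)).
have h2 := tail n (introT andP (conj s0 (le_trans st tT))).
have h3 := adjacent s0 st tT ts.
apply: le_trans (ler_distD (f (rnd n t)) _ _) _.
have h4 := ler_distD (f (rnd n s)) (f (rnd n t)) (f s).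
rewrite (distrC (f s)) in h2.
apply: le_trans (lerD h1 (le_trans h4 (lerD h3 h2))) _.
rewrite le_eqVlt; apply/orP; left; apply/eqP.
by rewrite exprS; field; rewrite gt_eqF.
Qed.

End dyadic_chaining.

Lemma dyadic_holder_on {R : realType} (T K gamma : R) (f : R -> R) : 0 < T ->
  0 <= K -> 0 < gamma -> {within `[0, T], continuous f} ->
  (forall n k, (k < 2 ^ n)%N -> `|f (dyadic T n k.+1) - f (dyadic T n k)|
     <= K * (2^-1 `^ gamma) ^+ n) ->
  exists2 C, 0 <= C & holder_on T C gamma f.
Proof.
move=> T0 K0 g0 cf hf.
have q_itv : 0 < (2^-1 : R) `^ gamma < 1.
  have one : 1 = 1 `^ gamma :> R by rewrite powR1.
  by rewrite powR_gt0//= [ltRHS]one gt0_ltr_powR ?nnegrE//; lra.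
have [q0 _] := andP q_itv.
have dT n k : (k <= 2 ^ n)%N -> 0 <= dyadic T n k <= T.
  move=> k2; rewrite /dyadic mulr_ge0 ?divr_ge0 ?exprn_ge0//=; last exact: ltW.
  by rewrite ger_pMr// ler_pdivrMr ?exprn_gt0// mul1r -natrX ler_nat.
have [|C C0 hC] := @dyadic_chaining R T K _ (f \o clamp T) T0 K0 q_itv
    (continuous_comp_clamp (ltW T0) cf).
  by move=> n k kn; rewrite /= !clamp_id ?dT ?hf//; exact: ltnW.
exists (C * (2^-1 `^ gamma)^-1 * T^-1 `^ gamma).
  by rewrite !mulr_ge0 ?powR_ge0 ?invr_ge0// powR_ge0.
move=> s t s0; rewrite le_eqVlt => /orP[/eqP <- _|st tT].
  by rewrite !subrr normr0 powR0 ?gt_eqF// mulr0.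
have ts : 0 < t - s by rewrite subr_gt0.
have ex : exists m, T / 2 ^+ m < t - s.
  exists (Num.bound (T / (t - s))); rewrite ltr_pdivrMr ?exprn_gt0// mulrC -ltr_pdivrMr//.
  apply: lt_trans (archi_boundP _) _; first by rewrite divr_ge0 ?ltW.
  by rewrite -natrX ltr_nat ltn_expl.
case: (ex_minnP ex) => -[|n] hn minn.
  by exfalso; move: hn; rewrite expr0 divr1; lra.
have tsn : t - s <= T / 2 ^+ n.
  by rewrite leNgt; apply/negP => /minn; rewrite ltnn.
have := hC s t n s0 (ltW st) tT tsn; rewrite /= !clamp_id; first last.
- by rewrite (le_trans s0 (ltW st)).
- by rewrite s0 (le_trans (ltW st)).
move=> /le_trans; apply; rewrite -!mulrA ler_wpM2l//.
rewrite -(ler_pM2l q0) mulVKf ?gt_eqF// -exprS.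
rewrite -powRM ?invr_ge0 ?(ltW T0) ?(ltW ts)// -powR_mulrn ?powR_ge0// -powRrM mulrC powRrM.
rewrite powR_mulrn ?invr_ge0// ge0_ler_powR ?nnegrE ?exprn_ge0 ?invr_ge0//.
- exact: ltW.
- by rewrite mulr_ge0 ?invr_ge0// ltW.
- by rewrite mulrC ler_pdivlMr// mulrC exprVn ltW.
Qed.

Section normal_estimates.
Context {R : realType}.
Implicit Types m s a r x : R.
Let mu := @lebesgue_measure R.

Lemma normal_peak_double s : normal_peak (2 * s) = normal_peak s / 2.
Proof.
rewrite /normal_peak -invfM; congr (_^-1).
have -> : (2 * s) ^+ 2 * pi *+ 2 = (s ^+ 2 * pi *+ 2) * 2 ^+ 2.
  by rewrite exprMn -!mulrnAl; ring.
have h : 0 <= s ^+ 2 * pi *+ 2 by rewrite mulrn_wge0// mulr_ge0 ?sqr_ge0 ?pi_ge0.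
by rewrite (sqrtrM _ h) sqrtr_sqr ger0_norm.
Qed.

Lemma normal_peak_le s : 0 < s -> normal_peak s <= (2 * s)^-1.
Proof.
move=> s0; rewrite /normal_peak lef_pV2 ?posrE ?mulr_gt0//; last first.
  by rewrite sqrtr_gt0 mulrn_wgt0// mulr_gt0 ?exprn_gt0 ?pi_gt0.
rewrite -[leLHS]ger0_norm ?mulr_ge0 ?(ltW s0)// -sqrtr_sqr ler_wsqrtr//.
have p2 := pi_ge2 R; have s2 : 0 < s ^+ 2 by rewrite exprn_gt0.
by rewrite exprMn -mulr_natr; nra.
Qed.

(* Doubling the standard deviation costs a factor 2 in the peak but gains the
   exponential of three quarters of the exponent. *)
Lemma normal_pdf_le_double m s a x : 0 < s -> 0 <= a -> a <= `|x - m| ->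
  normal_pdf m s x <= 2 * expR (- (a ^+ 2 / (4 * s ^+ 2))) * normal_pdf m (2 * s) x.
Proof.
move=> s0 a0 ax.
rewrite !normal_pdfE ?mulf_neq0 ?gt_eqF// /= normal_peak_double.
have pk := normal_peak_gt0 (lt0r_neq0 s0).
rewrite (_ : 2 * _ * _ = normal_peak s * (expR (- (a ^+ 2 / (4 * s ^+ 2)))
   * normal_fun m (2 * s) x)); last by field.
rewrite ler_pM2l// /normal_fun -expRD ler_expR.
have h : a ^+ 2 <= (x - m) ^+ 2.
  by rewrite -[leRHS]real_normK ?num_real// lerXn2r ?nnegrE.
have s2 : 0 < s ^+ 2 by rewrite exprn_gt0.
rewrite -subr_ge0.
rewrite (_ : _ - _ = ((x - m) ^+ 2 * 3 / 2 - a ^+ 2) / (4 * s ^+ 2)).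
  by rewrite divr_ge0 ?mulr_ge0 ?(ltW s2)//; have := sqr_ge0 (x - m); lra.
by field; rewrite gt_eqF.
Qed.

Lemma normal_prob_tail m s a : 0 < s -> 0 <= a ->
  (normal_prob m s [set x | (a < `|x - m|)%R] <=
    (2 * expR (- (a ^+ 2 / (4 * s ^+ 2))))%:E)%E.
Proof.
move=> s0 a0.
have mA : measurable [set x | a < `|x - m|].
  rewrite -[X in measurable X]setTI.
  have mf : measurable_fun setT (fun x : R => `|x - m|).
    by apply: measurableT_comp => //; exact: measurable_funB.
  have := mf measurableT _ (measurable_itv `]a, +oo[).
  by congr measurable; apply/seteqP; split => x /=; rewrite in_itv/= andbT.
set c := 2 * _.
have c0 : 0 <= c by rewrite mulr_ge0// expR_ge0.
have mpdf s' : measurable_fun setT (fun x => (normal_pdf m s' x)%:E).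
  by apply/measurable_EFinP; exact: measurable_normal_pdf.
rewrite /normal_prob.
apply: (@le_trans _ _ (\int[mu]_(x in [set x | (a < `|x - m|)%R])
    (c * normal_pdf m (2 * s) x)%:E)%E).
  apply: ge0_le_integral => //=.
  - by move=> x _; rewrite lee_fin normal_pdf_ge0.
  - exact: measurable_funTS (mpdf s).
  - apply: measurable_funTS; apply/measurable_EFinP.
    by apply: measurable_funM => //; exact: measurable_normal_pdf.
  - by move=> x ax; rewrite lee_fin normal_pdf_le_double// ltW.
apply: (@le_trans _ _ (\int[mu]_x (c%:E * (normal_pdf m (2 * s) x)%:E))%E).
  apply: ge0_subset_integral => //=.
  - apply/measurable_EFinP/measurable_funM => //.
    exact: measurable_normal_pdf.
  - by move=> x _; rewrite lee_fin mulr_ge0// normal_pdf_ge0.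
rewrite ge0_integralZl//=.
- by rewrite integral_normal_pdf mule1.
- exact: mpdf.
- by move=> x _; rewrite lee_fin normal_pdf_ge0.
Qed.

Lemma normal_prob_itv m s r : 0 < s -> 0 <= r ->
  (normal_prob m s `](- r)%R, r[ <= (r / s)%:E)%E.
Proof.
move=> s0 r0; rewrite /normal_prob.
apply: (@le_trans _ _ (\int[mu]_(x in `](- r)%R, r[) (cst (2 * s)^-1%:E x))%E).
  apply: ge0_le_integral => //=.
  - by move=> x _; rewrite lee_fin normal_pdf_ge0.
  - apply: measurable_funTS; apply/measurable_EFinP.
    exact: measurable_normal_pdf.
  - move=> x _; rewrite lee_fin (le_trans (normal_pdf_ub _ _ _)) ?gt_eqF//.
    exact: normal_peak_le.
rewrite integral_cst//= lebesgue_measure_itv/= lte_fin.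
case: ifPn => h; last by rewrite mule0 lee_fin divr_ge0// ltW.
rewrite -EFinB -EFinM lee_fin le_eqVlt; apply/orP; left; apply/eqP.
by field; rewrite gt_eqF.
Qed.

End normal_estimates.

Section gaussian_tail.
Context {R : realType} (d : measure_display) (Om : measurableType d).
Variable P : probability Om R.

(* The bounds on the mean and standard deviation come from Chebyshev's
   inequality: |Y| < 2 sqrt v with probability at least 3/4. *)
Lemma gaussian_rv_tail (Y : {RV P >-> R}) (v a : R) :
  gaussian_rv P Y -> 0 < v ->
  (\int[P]_w ((Y w) ^+ 2)%:E = v%:E)%E -> 0 <= a -> 784 * v <= a ^+ 2 ->
  (P [set w | (a < `|Y w|)%R] <= (2 * expR (- (a ^+ 2 / (128 * v))))%:E)%E.
Proof.
move=> [m [s [s0 lawY]]] v0 EY a0 av.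
pose r := 2 * Num.sqrt v.
have r0 : 0 < r by rewrite mulr_gt0// sqrtr_gt0.
have r2 : r ^+ 2 = 4 * v by rewrite exprMn sqr_sqrtr ?ltW//; ring.
have cheb : (P [set w | (r%:E <= `|(Y w)%:E|)%E] <= (4^-1)%:E)%E.
  have homo2 : {in Num.nneg &, {homo (fun x : R => x ^+ 2) : x y / x <= y}}.
    by move=> x y; rewrite !nnegrE => x0 y0; rewrite ler_sqr.
  have := @markov _ _ _ P Y (fun x => x ^+ 2) r r0 (exprn_measurable _)
    (fun x _ => sqr_ge0 x) homo2.
  rewrite r2 unlock.
  under eq_integral do rewrite /= real_normK ?num_real//.
  rewrite EY => h; rewrite -(@lee_pmul2l _ (4 * v)%:E)//; last first.
    by rewrite lte_fin mulr_gt0.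
  by rewrite (le_trans h)// -EFinM lee_fin; lra.
have mpre A : measurable A -> measurable (Y @^-1` A).
  by move=> mA; rewrite -[X in measurable X]setTI; exact: measurable_funP.
have small : ((3 / 4)%:E <= P (Y @^-1` `](- r)%R, r[))%E.
  have -> : Y @^-1` `](- r)%R, r[ = ~` [set w | (r%:E <= `|(Y w)%:E|)%E].
    apply/seteqP; split=> w /=; rewrite in_itv/= lee_fin -ltr_norml => h.
      by apply/negP; rewrite -ltNge.
    by rewrite ltNge; apply/negP.
  rewrite probability_setC; last first.
    rewrite (_ : [set _ | _] = Y @^-1` [set x | r <= `|x|]); last first.
      by apply/seteqP; split=> w /=; rewrite lee_fin.
    apply: mpre; rewrite -[X in measurable X]setTI.
    have mf : measurable_fun setT (fun x : R => `|x|) by exact: measurableT_comp.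
    have := mf measurableT _ (measurable_itv `[r, +oo[).
    by congr measurable; apply/seteqP; split => x /=; rewrite in_itv/= andbT.
  have -> : (3 / 4)%:E = (1 - (4^-1)%:E)%E :> \bar R.
    by rewrite -EFinB; congr EFin; lra.
  by apply: leeB.
have mtail c b : measurable [set x : R | b < `|x - c|].
  rewrite -[X in measurable X]setTI.
  have mf : measurable_fun setT (fun x : R => `|x - c|).
    by apply: measurableT_comp => //; exact: measurable_funB.
  have := mf measurableT _ (measurable_itv `]b, +oo[).
  by congr measurable; apply/seteqP; split => x /=; rewrite in_itv/= andbT.
have preE : [set w | a < `|Y w|] = Y @^-1` [set x | a < `|x - 0|].
  by apply/seteqP; split=> w /=; rewrite subr0.
rewrite preE lawY//.
have ra : 14 * r <= a.
  by rewrite -ler_sqr ?nnegrE ?mulr_ge0 ?(ltW r0)// exprMn r2; lra.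
move: small; rewrite lawY//; case: eqP => [_|/eqP sn0].
  rewrite !diracE; case: (boolP (m \in _)) => [|_]; last first.
    by rewrite lee_fin /= => h; exfalso; move: h; apply/negP; rewrite -ltNge divr_gt0.
  rewrite inE /= in_itv/= -ltr_norml => mr _.
  rewrite memNset ?lee_fin ?mulr_ge0 ?expR_ge0//= subr0 => am; lra.
have {}s0 : 0 < s by rewrite lt_neqAle eq_sym sn0.
move=> small.
have sr : s <= 4 / 3 * r.
  have := le_trans small (normal_prob_itv m s0 (ltW r0)).
  by rewrite lee_fin ler_pdivlMr//; lra.
have mr : `|m| <= 7 * r.
  rewrite leNgt; apply/negP => rm.
  have s40 : 0 <= 4 * s by rewrite mulr_ge0// ltW.
  have sub : (normal_prob m s `](- r)%R, r[ <=
      normal_prob m s [set x | (4 * s < `|x - m|)%R])%E.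
    apply: le_measure; rewrite ?inE//; first exact: mtail.
    move=> x /=; rewrite in_itv/= -ltr_norml => xr.
    by have := lerB_dist m x; rewrite distrC; lra.
  have := le_trans small (le_trans sub (normal_prob_tail m s0 s40)).
  rewrite lee_fin.
  rewrite (_ : (4 * s) ^+ 2 / (4 * s ^+ 2) = 4); last by field; rewrite gt_eqF.
  rewrite expRN; have e5 : 5 <= expR 4 :> R by have := expR_ge1Dx (4 : R); lra.
  have : (expR 4)^-1 <= 5^-1 :> R by rewrite lef_pV2 ?posrE ?expR_gt0//.
  by lra.
have a20 : 0 <= a / 2 by rewrite divr_ge0.
have sub : (normal_prob m s [set x | (a < `|x - 0|)%R] <=
    normal_prob m s [set x | (a / 2 < `|x - m|)%R])%E.
  apply: le_measure; rewrite ?inE; [exact: mtail|exact: mtail|].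
  move=> x /=; rewrite subr0 => ax.
  by have := lerB_dist x m; lra.
apply: le_trans sub (le_trans (normal_prob_tail m s0 a20) _).
rewrite lee_fin ler_pM2l// ler_expR lerN2.
have s2 : s ^+ 2 <= 16 / 9 * (4 * v).
  rewrite -r2; have -> : 16 / 9 * r ^+ 2 = (4 / 3 * r) ^+ 2 by field.
  by rewrite ler_sqr ?nnegrE ?mulr_ge0// ltW.
rewrite (_ : (a / 2) ^+ 2 / (4 * s ^+ 2) = a ^+ 2 / (16 * s ^+ 2)); last first.
  by field; rewrite gt_eqF.
rewrite ler_wpM2l ?sqr_ge0// lef_pV2 ?posrE ?mulr_gt0 ?exprn_gt0//; lra.
Qed.

End gaussian_tail.

Section geometric_decay.
Context {R : realType}.
Implicit Types rho c x r : R.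

Lemma exprn_unbounded rho x : 1 < rho -> exists n : nat, x <= rho ^+ n.
Proof.
move=> r1; have d0 : 0 < rho - 1 by rewrite subr_gt0.
have bernoulli n : 1 + n%:R * (rho - 1) <= rho ^+ n.
  elim: n => [|n IH]; first by rewrite mul0r addr0 expr0.
  rewrite exprS -natr1; have n0 : 0 <= n%:R :> R by [].
  have := ler_wpM2l (ltW (lt_trans ltr01 r1)) IH.
  by have := mulr_ge0 n0 (sqr_ge0 (rho - 1)); lra.
exists (Num.bound (`|x| / (rho - 1))); apply: le_trans (bernoulli _).
have := archi_boundP (divr_ge0 (normr_ge0 x) (ltW d0)).
by rewrite ltr_pdivrMr//; have := ler_norm x; lra.
Qed.

Lemma exprn_powR x r n : 0 <= x -> (x ^+ n) `^ r = (x `^ r) ^+ n.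
Proof.
move=> x0; rewrite -(powR_mulrn n x0) -(powR_mulrn n (powR_ge0 x r)).
exact: powRAC.
Qed.

Lemma expR_geometric_decay rho c : 1 < rho -> 0 < c ->
  exists2 D, 0 <= D & forall n : nat,
    2 ^+ n * (2 * expR (- (rho ^+ n / c))) <= D / 2 ^+ n.
Proof.
move=> r1 c0; have [j hj] := exprn_unbounded 4 r1.
have r0 : 0 < rho := lt_trans ltr01 r1.
pose j' := j.+1.
have {}hj : 4 <= rho ^+ j'.
  by apply: le_trans hj _; rewrite exprS ler_peMl ?exprn_ge0 ?ltW.
have f0 : 0 < j'`!%:R :> R by rewrite ltr0n fact_gt0.
exists (2 * (j'`!%:R * c ^+ j')) => [|n].
  by rewrite !mulr_ge0 ?exprn_ge0 ?ltW.
have x0 : 0 <= rho ^+ n / c by rewrite divr_ge0 ?exprn_ge0 ?ltW.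
have low : 4 ^+ n / (j'`!%:R * c ^+ j') <= expR (rho ^+ n / c).
  apply: le_trans (expR_ge1Dxn j x0); rewrite -/j'.
  apply: le_trans (_ : (rho ^+ n / c) ^+ j' / j'`!%:R <= _); last by rewrite lerDr.
  rewrite expr_div_n -exprM mulnC exprM -mulrA -invfM [c ^+ _ * _]mulrC.
  apply: ler_wpM2r; first by rewrite invr_ge0 mulr_ge0// exprn_ge0// ltW.
  by rewrite lerXn2r ?nnegrE ?exprn_ge0// ltW.
have F0 : 0 < j'`!%:R * c ^+ j' by rewrite mulr_gt0// exprn_gt0.
have p2 : 0 < 2 ^+ n :> R by rewrite exprn_gt0.
have up : expR (- (rho ^+ n / c)) <= (j'`!%:R * c ^+ j') / 4 ^+ n.
  by rewrite expRN -[leRHS]invf_div lef_pV2 ?posrE ?expR_gt0 ?divr_gt0 ?exprn_gt0.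
apply: le_trans (ler_wpM2l (ltW p2) (ler_wpM2l (ler0n _ 2) up)) _.
have -> : 4 ^+ n = 2 ^+ n * 2 ^+ n :> R by rewrite -exprMn; congr (_ ^+ _); ring.
rewrite le_eqVlt; apply/orP; left; apply/eqP; field.
by rewrite gt_eqF.
Qed.

End geometric_decay.

Section fBm_regularity.
Context {R : realType} (d : measure_display) (Om : measurableType d).
Variables (P : probability Om R) (H : R) (B : R -> {RV P >-> R}).
Hypotheses (H_gt0 : 0 < H) (B_fBm : fBm H B).

Let cov t s : 0 <= t -> 0 <= s -> (\int[P]_w (B t w * B s w)%:E =
  (2^-1 * (s `^ (2 * H) + t `^ (2 * H) - `|t - s| `^ (2 * H)))%:E)%E.
Proof. by case: B_fBm => _ _ _ h t0 s0; rewrite -(h t s t0 s0) unlock. Qed.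

Let mprod t s : measurable_fun setT (fun w => B t w * B s w).
Proof. by apply: measurable_funM; exact: measurable_funP. Qed.

Let integrable_sq t : 0 <= t ->
  P.-integrable setT (fun w => (B t w * B t w)%:E).
Proof.
move=> t0; apply/integrableP; split; first exact/measurable_EFinP/mprod.
under eq_integral do rewrite abse_EFin ger0_norm -?expr2 ?sqr_ge0// expr2.
by rewrite cov// ltry.
Qed.

Let integrable_prod t s : 0 <= t -> 0 <= s ->
  P.-integrable setT (fun w => (B t w * B s w)%:E).
Proof.
move=> t0 s0.
apply: (le_integrable measurableT _ _
  (integrableD measurableT (integrable_sq t0) (integrable_sq s0))).
  exact/measurable_EFinP/mprod.
move=> w _; rewrite -EFinD !abse_EFin lee_fin.
rewrite [leRHS]ger0_norm -?expr2 ?addr_ge0 ?sqr_ge0// ler_norml.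
have := sqr_ge0 (B t w + B s w); have := sqr_ge0 (B t w - B s w).
have := sqr_ge0 (B t w); have := sqr_ge0 (B s w).
by move=> *; apply/andP; split; lra.
Qed.

Lemma fBm_increment_sqr t s : 0 <= t -> 0 <= s ->
  (\int[P]_w ((B t w - B s w) ^+ 2)%:E = (`|t - s| `^ (2 * H))%:E)%E.
Proof.
move=> t0 s0.
have -> : (fun w => ((B t w - B s w) ^+ 2)%:E) = (fun w =>
    (B t w * B t w)%:E + (B s w * B s w)%:E - (2%:E * (B t w * B s w)%:E))%E.
  apply/funext => w; rewrite -EFinM -EFinD; congr EFin; ring.
rewrite integralB//=.
- rewrite integralD//=; [|exact: integrable_sq..].
  rewrite integralZl//=; last exact: integrable_prod.
  rewrite !cov// -EFinM -EFinD; congr EFin.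
  rewrite !subrr normr0 powR0 ?mulf_neq0 ?gt_eqF//; by field.
- exact: (integrableD measurableT (integrable_sq t0) (integrable_sq s0)).
- exact: (integrableZl measurableT 2 (integrable_prod t0 s0)).
Qed.

Lemma fBm_increment_gaussian t s : 0 <= t -> 0 <= s ->
  gaussian_rv P (B t \- B s)%R.
Proof.
move=> t0 s0; case: B_fBm => _ G _ _.
have := G 2%N (fun i => if i == ord0 then t else s)
  (fun i => if i == ord0 then 1 else -1).
rewrite (_ : (fun w => _) = (B t \- B s)); first by apply; move=> i; case: ifP.
by apply/funext => w; rewrite !big_ord_recl big_ord0 /= addr0; ring.
Qed.

Variables (T gamma : R).
Hypotheses (T_gt0 : 0 < T) (gamma_itv : 0 < gamma < H).

Let q : R := 2^-1 `^ gamma.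
Let h : R := 2^-1 `^ (2 * H).
Let rho : R := q ^+ 2 / h.

Let q_gt0 : 0 < q. Proof. exact: powR_gt0. Qed.
Let h_gt0 : 0 < h. Proof. exact: powR_gt0. Qed.

Let rho_gt1 : 1 < rho.
Proof.
rewrite /rho ltr_pdivlMr// mul1r /q -powR_mulrn ?powR_ge0// -powRrM /h.
rewrite /powR gt_eqF// ltr_expR ltr_nM2r ?ln_lt0//; last by apply/andP; split; lra.
by case/andP: gamma_itv => _; rewrite mulrC ltr_pM2l.
Qed.

Let v n : R := T `^ (2 * H) * h ^+ n.

Let dyadic_lag n k : `|dyadic T n k.+1 - dyadic T n k| `^ (2 * H) = v n.
Proof.
have -> : dyadic T n k.+1 - dyadic T n k = T * 2^-1 ^+ n.
  rewrite /dyadic -natr1 exprVn; field.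
  by rewrite expf_neq0.
rewrite ger0_norm ?mulr_ge0 ?exprn_ge0 ?(ltW T_gt0)//.
rewrite powRM ?exprn_ge0 ?(ltW T_gt0)// /v; congr (_ * _).
exact: exprn_powR.
Qed.

Let E n k := [set w | q ^+ n < `|B (dyadic T n k.+1) w - B (dyadic T n k) w|].

Let mE n k : measurable (E n k).
Proof.
rewrite -[X in measurable X]setTI.
have mf : measurable_fun setT
    (fun w => `|B (dyadic T n k.+1) w - B (dyadic T n k) w|).
  apply: measurableT_comp => //.
  by apply: measurable_funB; exact: measurable_funP.
have := mf measurableT _ (measurable_itv `]q ^+ n, +oo[).
by congr measurable; apply/seteqP; split => x /=; rewrite in_itv/= andbT.
Qed.

Let c := 128 * T `^ (2 * H).
Let c_gt0 : 0 < c. Proof. by rewrite mulr_gt0// powR_gt0. Qed.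

Let PE n k : 784 * T `^ (2 * H) <= rho ^+ n ->
  (P (E n k) <= (2 * expR (- (rho ^+ n / c)))%:E)%E.
Proof.
move=> big.
have dy0 m l : 0 <= dyadic T m l.
  by rewrite /dyadic mulr_ge0 ?divr_ge0 ?exprn_ge0 ?(ltW T_gt0).
have qE : (q ^+ n) ^+ 2 = rho ^+ n * h ^+ n.
  by rewrite -exprMn /rho divfK ?gt_eqF// -!exprM mulnC.
have v0 : 0 < v n by rewrite mulr_gt0 ?powR_gt0 ?exprn_gt0.
have := @gaussian_rv_tail R d Om P
  (B (dyadic T n k.+1) \- B (dyadic T n k)) (v n) (q ^+ n)
  (fBm_increment_gaussian (dy0 _ _) (dy0 _ _)) v0.
rewrite /= fBm_increment_sqr// dyadic_lag => /(_ erefl (exprn_ge0 _ (ltW q_gt0))).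
rewrite qE /v mulrA ler_pM2r ?exprn_gt0// => /(_ big).
rewrite mulrA -/c invfM mulrACA divff ?mulr1// gt_eqF// exprn_gt0//.
Qed.

Let A n := \big[setU/set0]_(k < 2 ^ n) E n k.

Let mA n : measurable (A n).
Proof. by apply: bigsetU_measurable => k _; exact: mE. Qed.

Let sum_PA : (\sum_(n <oo) P (A n) < +oo)%E.
Proof.
have [D D0 hD] := expR_geometric_decay rho_gt1 c_gt0.
have [N hN] := exprn_unbounded (784 * T `^ (2 * H)) rho_gt1.
pose K := D + 2 ^+ N.
have K0 : 0 <= K by rewrite addr_ge0// exprn_ge0.
have PA n : (P (A n) <= ((2 * K) / (2 ^ n.+1)%:R)%:E)%E.
  rewrite natrX exprS -mulf_div divff// mul1r.
  have [nN|Nn] := ltnP n N.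
    apply: le_trans (probability_le1 P (mA n)) _; rewrite lee_fin.
    rewrite ler_pdivlMr ?exprn_gt0// mul1r /K.
    by apply: le_trans (_ : 2 ^+ N <= _); rewrite ?lerDr// ler_weXn2l ?ler1n// ltnW.
  have big : 784 * T `^ (2 * H) <= rho ^+ n.
    by apply: le_trans hN _; rewrite ler_weXn2l// ltW.
  apply: le_trans (@Boole_inequality _ _ _ P (E n) (2 ^ n)%N (fun k _ => mE n k)) _.
  apply: (@le_trans _ _ (\sum_(k < 2 ^ n) (2 * expR (- (rho ^+ n / c)))%:E)%E).
    by apply: lee_sum => k _; exact: PE.
  rewrite sumEFin sumr_const card_ord lee_fin -[leLHS]mulr_natl natrX.
  apply: le_trans (hD n) _; rewrite ler_pM2r ?invr_gt0 ?exprn_gt0//.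
  by rewrite lerDl exprn_ge0.
apply: le_lt_trans (ltry (2 * K)).
apply: le_trans (epsilon_trick0 xpredT _); last by rewrite mulr_ge0.
by apply: lee_nneseries => // n _.
Qed.

Lemma fBm_holder : {ae P, forall w, exists2 C, 0 <= C &
  holder_on T C gamma (fun t => B t w)}.
Proof.
have lim0 : P.-negligible (lim_sup_set A).
  exists (lim_sup_set A); split => //; last exact: (lim_sup_set_cvg0 mA sum_PA).
  apply: bigcap_measurable => // n _; apply: bigcup_measurable => k _; exact: mA.
have cont : {ae P, forall w, {within `[0, +oo[, continuous (fun t => B t w)}}.
  by case: B_fBm.
have nlim : {ae P, forall w, ~ lim_sup_set A w}.
  by apply: negligibleS lim0 => w /=; rewrite notK.
apply: filterS2 cont nlim => w cw nw.
have [N hN] : exists N, forall n, (N <= n)%N -> ~ A n w.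
  apply: contrapT => hN; apply: nw => n _ /=.
  apply: contrapT => hn; apply: hN; exists n => m nm Am; apply: hn.
  by exists m.
pose inc n k := `|B (dyadic T n k.+1) w - B (dyadic T n k) w|.
have inc0 n k : 0 <= inc n k / q ^+ n.
  by apply: divr_ge0; [exact: normr_ge0|exact: exprn_ge0 (ltW q_gt0)].
pose K := 1 + \sum_(n < N) \sum_(k < 2 ^ n) inc n k / q ^+ n.
have K1 : 1 <= K by rewrite lerDl sumr_ge0// => n _; rewrite sumr_ge0.
apply: (@dyadic_holder_on R T K gamma) => //.
- exact: le_trans K1.
- by case/andP: gamma_itv.
- by apply: continuous_subspaceW cw => x /=; rewrite !in_itv/= andbT => /andP[].
move=> n k kn; rewrite -/q -/(inc n k) -ler_pdivrMr ?exprn_gt0//.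
have [nN|Nn] := ltnP n N.
  apply: le_trans (_ : \sum_(n < N) \sum_(k < 2 ^ n) inc n k / q ^+ n <= _).
    rewrite (bigD1 (Ordinal nN))//= (bigD1 (Ordinal kn))//= -addrA lerDl.
    by rewrite addr_ge0// sumr_ge0// => i _; rewrite ?sumr_ge0.
  by rewrite lerDr.
apply: le_trans K1; rewrite ler_pdivrMr ?exprn_gt0// mul1r leNgt; apply/negP => big.
apply: (hN n Nn); exact: (bigsetU_sup (F := E n) kn).
Qed.

End fBm_regularity.

(** * Solutions as processes *)

Section measurability.
Context {R : realType} (d : measure_display) (Om : measurableType d).
Variable P : probability Om R.

Lemma measurable_piece_sum (f : R -> R) (B : R -> {RV P >-> R}) l (a : R) :
  measurable_fun setT (fun w => piece_sum (RS_piece f (fun s => B s w)) a l).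
Proof.
elim: l a => [|[x c] l IH] a /=; first exact: measurable_cst.
apply: measurable_funD => //; apply: measurable_funM => //.
by apply: measurable_funB; exact: measurable_funP.
Qed.

(* The upper limit of the sums along one sequence of partitions is a measurable
   version of the integral. *)
Lemma RS_integral_measurable (f : R -> R) (B : R -> {RV P >-> R}) (t : R) :
  0 <= t -> {ae P, forall w, RS_integrable f (fun s => B s w) 0 t} ->
  exists2 I : Om -> R, measurable_fun setT I &
    {ae P, forall w, RS_integral f (fun s => B s w) 0 t = I w}.
Proof.
move=> t0 hB.
have n0 n : 0 < n.+1%:R^-1 :> R by rewrite invr_gt0.
have /choice[l hl] := fun n => tagged_partition_exists (n0 n) t0.
pose S n w := piece_sum (RS_piece f (fun s => B s w)) 0 (l n).
exists (fun w => fine (limn_esup (fun n => (S n w)%:E))).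
  apply: measurableT_comp; first exact: fine_measurable.
  apply: (@measurable_fun_limn_esup _ _ _ setT (fun n w => (S n w)%:E)) => n.
  exact/measurable_EFinP/measurable_piece_sum.
apply: filterS hB => w /RS_integralP.
set J := RS_integral _ _ _ _ => /is_RS_integralE hJ.
suff SJ : (S n w)%:E @[n --> \oo] --> J%:E.
  by have [_ ->] := cvg_limn_einf_sup SJ.
apply: cvg_EFin; first exact: nearW.
apply/cvgrPdist_lt => e /hJ[dl dl0 hd].
exists (Num.bound dl^-1) => // n /= Nn.
rewrite distrC; apply/hd/(tagged_partition_widen _ (hl n)).
rewrite invf_ple ?posrE//; apply: le_trans (ltW (archi_boundP _)) _.
  by rewrite invr_ge0 ltW.
by rewrite ler_nat leqW.
Qed.

End measurability.

Unset Implicit Arguments.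

Theorem theorem13 (R : realType) (d : measure_display) (Om : measurableType d)
    (P : probability Om R) (T H x0 alpha beta sigma eps : R)
    (B : R -> {RV P >-> R}) :
  0 < T -> 2^-1 < H < 1 -> 0 < x0 -> beta != 0 ->
  fBm H B ->
  0 < eps < H - 2^-1 ->
  let Heps := (H - eps)^-1 in
  let X := gompertz_process alpha beta sigma x0 B in
  [/\ {ae P, forall w, forall t, 0 <= t <= T ->
         RS_integrable (gompertz_kernel beta t) (fun s => B s w) 0 t},
      CW_process P Heps T X,
      gompertz_solution T alpha beta sigma x0 B X &
      forall Y Z : R -> Om -> R,
        CW_process P Heps T Y -> gompertz_solution T alpha beta sigma x0 B Y ->
        CW_process P Heps T Z -> gompertz_solution T alpha beta sigma x0 B Z ->
        {ae P, forall w, forall t, 0 <= t <= T -> Y t w = Z t w}].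
Proof.
move=> T0 /andP[H2 H1] x0_gt0 b0 hB /andP[e0 eH] Heps X.
have g12 : 2^-1 < H - eps <= 1 by apply/andP; split; lra.
have g0H : 0 < H - eps < H by apply/andP; split; lra.
have H0 : 0 < H by lra.
have cont : {ae P, forall w, {within `[0, T], continuous (fun t => B t w)}}.
  case: hB => c _ _ _; apply: filterS c => w; apply: continuous_subspaceW => x /=.
  by rewrite !in_itv/= andbT => /andP[].
have hol := fBm_holder H0 hB T0 g0H.
have kernel : {ae P, forall w, forall t, 0 <= t <= T ->
    RS_integrable (gompertz_kernel beta t) (fun s => B s w) 0 t}.
  by apply: filterS cont => w cw t tT; exact: (gompertz_kernel_integrable beta T0 cw tT).
split => //.
- split; last first.
    apply: filterS2 cont hol => w cw [C C0 hC].
    exact: (gompertz_sol_CW alpha sigma x0 T0 b0 g12 C0 cw hC).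
  move=> t tT; have /andP[t0 _] := tT.
  have [|I mI hI] := @RS_integral_measurable R d Om P (gompertz_kernel beta t) B t t0.
    by apply: filterS kernel => w; exact.
  pose Y w := expR (expR (- beta * t) * ln x0
    + alpha / beta * (1 - expR (- beta * t)) + sigma * I w).
  have mY : measurable_fun setT Y.
    apply: measurableT_comp => //; apply: measurable_funD => //.
    exact: measurable_funM.
  pose Yrv : {RV P >-> R} := HB.pack Y (isMeasurableFun.Build _ _ _ _ Y mY).
  exists Yrv; apply: filterS hI => w hw _.
  by rewrite /X /gompertz_process hw.
- apply: filterS2 cont hol => w cw [C C0 hC].
  exact: (gompertz_sol_path alpha sigma T0 b0 x0_gt0 g12 C0 cw hC).
- move=> Y Z [_ cY] hY [_ cZ] hZ.
  have p2 : 0 < Heps < 2.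
    rewrite invr_gt0; apply/andP; split; first by lra.
    by rewrite invf_plt ?posrE; lra.
  apply: filterS2 (filterI cY hY) (filterI cZ hZ) => w [cy hy] [cz hz].
  exact: (gompertz_path_unique T0 p2 cy cz hy hz).
Qed.
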